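(* Let $s \in (0,1)$ and $b \in L^1([0,1])$. Then the dyadic paraproduct $\Pi_b$ is bounded on $H^s$ if and only if $b \in \mathrm{BMO}^s$, and, in this case, $$\|\Pi_b\|_{H^s\rightarrow H^s} \approx \|b\|_{\mathrm{BMO}^s},$$ where $\approx$ denotes two-sided comparability with positive constants independent of $b$ (they may depend on $s$). Moreover, $\Pi_b$ is compact on $H^s$ if and only if $b \in \mathrm{CMO}^s$.
   Context: All functions are real-valued and defined on $I_0=[0,1]$; $L^p=L^p([0,1])$; $(f,g)=\int_{I_0} f(x)g(x)\,dx$; $\langle f\rangle_I=|I|^{-1}\int_I f(x)\,dx$. Dyadic system: $\mathcal D=\{2^{-j}([0,1)+k): j=0,1,2,\dots,\ k=0,\dots,2^j-1\}$; the top interval $[0,1)$ is identified with $I_0$. For $I\in\mathcal D$, $I_-,I_+$ are its left and right halves (dyadic children), $h_I=|I|^{-1/2}(\mathbb 1_{I_-}-\mathbb 1_{I_+})$ is the Haar function, and $\mathcal D(I)=\{J\in\mathcal D: J\subseteq I\}$. For $N\in\mathbb N$, $\mathcal D_N=\{I\in\mathcal D: |I|\ge 2^{-N}\}$ and $\mathcal D_N^c=\mathcal D\setminus\mathcal D_N$. Local dyadic fractional Sobolev space: $D^sf=\sum_{I\in\mathcal D}|I|^{-s}(f,h_I)h_I$, and $H^s$ is the set of $f\in L^2$ with $\|f\|_{H^s}^2:=\|D^sf\|_{L^2}^2+\|f\|_{L^2}^2<\infty$, where $\|D^sf\|_{L^2}^2=\sum_{I\in\mathcal D}|I|^{-2s}|(f,h_I)|^2$.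 Dyadic Sobolev $s$-capacity: for $E\subseteq I_0$, $\mathrm{Cap}_s(E)=\inf\{\|f\|_{H^s}^2: f\in H^s,\ f\ge 1 \text{ a.e. on } E\}$ (equal to $\infty$ if no such $f$ exists). $b\in\mathrm{BMO}^s$ means $b\in L^1$ and $$\|b\|_{\mathrm{BMO}^s}:=\sup_{\{I_k\}_{k=1}^n}\Big(\frac{1}{\mathrm{Cap}_s(\bigcup_{k=1}^n I_k)}\sum_{k=1}^n\sum_{J\in\mathcal D(I_k)}|J|^{-2s}|(b,h_J)|^2\Big)^{1/2}<\infty,$$ and $b\in\mathrm{CMO}^s$ means $b\in\mathrm{BMO}^s$ and $$\lim_{N\to\infty}\sup_{\{I_k\}_{k=1}^n}\frac{1}{\mathrm{Cap}_s(\bigcup_{k=1}^n I_k)}\sum_{k=1}^n\sum_{J\in\mathcal D(I_k)\cap\mathcal D_N^c}|J|^{-2s}|(b,h_J)|^2=0,$$ the suprema being over all nonempty finite collections of pairwise disjoint intervals $\{I_k\}_{k=1}^n\subseteq\mathcal D$. Functions differing by a constant are identified in these spaces. Dyadic paraproduct: $\Pi_bf=\sum_{I\in\mathcal D}(b,h_I)\langle f\rangle_I h_I$. Bounded on $H^s$ means that for every $f\in H^s$ the series defines an element of $H^s$ and $\|\Pi_bf\|_{H^s}\le C\|f\|_{H^s}$ with $C$ independent of $f$; $\|\Pi_b\|_{H^s\to H^s}$ is the operator norm. *)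

(* Defs.v *)
From HB Require Import structures.
From mathcomp Require Import all_boot all_order all_algebra finmap.
From mathcomp Require Import all_classical all_reals all_analysis.

Set Implicit Arguments.
Unset Strict Implicit.
Unset Printing Implicit Defensive.
Import Order.TTheory GRing.Theory Num.Theory.
Import numFieldNormedType.Exports.

Local Open Scope classical_set_scope.
Local Open Scope ring_scope.

Notation leb R := (@lebesgue_measure R).

Definition I0 (R : realType) : set R := `[0, 1]%classic.

(* [Tagged _ k] with tag [j] stands for [2^-j k, 2^-j (k + 1)).  The top interval
   is thus [0, 1), which differs from [I0] by a null set. *)
Definition dyadic : Type := {j : nat & 'I_(2 ^ j)}.

Section Dyadic.
Variable R : realType.
Implicit Types (I J : dyadic).

Definition dlen I : R := 2 ^- tag I.

Definition dset I : set R :=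
  `[(tagged I)%:R * dlen I, (tagged I).+1%:R * dlen I[%classic.

Definition dleft I : set R :=
  `[(tagged I)%:R * dlen I, ((tagged I)%:R + 2^-1) * dlen I[%classic.

Definition dright I : set R :=
  `[((tagged I)%:R + 2^-1) * dlen I, (tagged I).+1%:R * dlen I[%classic.

Definition haar I (x : R) : R :=
  dlen I `^ (- 2^-1) * (\1_(dleft I) x - \1_(dright I) x).

Definition sub_dyadic I : set dyadic := [set J | dset J `<=` dset I].

(* The functions under study live on [I0]; they are represented by total
   functions [R -> R] whose values outside [I0] play no role. *)
Implicit Types (f g b : R -> R).

Definition inL1 f : Prop := (leb R).-integrable (@I0 R) (EFin \o f).

Definition inL2 f : Prop := f \_ (@I0 R) \in Lfun (leb R) 2%:E.

Definition L2norm f : \bar R := 'N[leb R]_2%:E[EFin \o (f \_ (@I0 R))].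

Definition inner f g : R := \int[leb R]_(x in @I0 R) (f x * g x).

Definition avg f I : R := (dlen I)^-1 * \int[leb R]_(x in dset I) f x.

End Dyadic.

Arguments dset R I : clear implicits.
Arguments sub_dyadic R I : clear implicits.

Section Spaces.
Variables (R : realType) (s : R).
Implicit Types (I J : dyadic) (f g b : R -> R) (E : set R).

Definition haar_energy f J : R :=
  dlen R J `^ (- (2 * s)) * `|inner f (haar J)| ^+ 2.

Definition Hs_normsq f : \bar R :=
  (\esum_(J in [set: dyadic]) (haar_energy f J)%:E + L2norm f ^+ 2)%E.

Definition Hs_norm f : \bar R := sqrte (Hs_normsq f).

Definition inHs f : Prop := inL2 f /\ (Hs_normsq f < +oo)%E.

Definition Cap E : \bar R :=
  ereal_inf [set Hs_normsq f | f in
    [set f | inHs f /\ {ae leb R, forall x, E x -> 1 <= f x}]].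

(* Nonempty finite families of pairwise disjoint dyadic intervals; since the
   intervals are nonempty, disjointness makes the family injective. *)
Definition disjoint_family n (I : 'I_n.+1 -> dyadic) : Prop :=
  trivIset [set: 'I_n.+1] (fun k => dset R (I k)).

(* Both the BMO^s and the CMO^s conditions are suprema of this type; [P] selects
   the dyadic intervals that contribute to the inner sums. *)
Definition carleson_sup (P : set dyadic) b : \bar R :=
  ereal_sup [set x | exists n (I : 'I_n.+1 -> dyadic), disjoint_family I /\
    x = ((\sum_(k < n.+1)
            \esum_(J in sub_dyadic R (I k) `&` P) (haar_energy b J)%:E)
         / Cap (\bigcup_k dset R (I k)))%E].

Definition BMOs_norm b : \bar R := sqrte (carleson_sup setT b).

Definition inBMOs b : Prop := inL1 b /\ (BMOs_norm b < +oo)%E.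

Definition inCMOs b : Prop :=
  inBMOs b /\
  (fun N : nat => carleson_sup [set J | dlen R J < 2 ^- N] b) @ \oo --> 0%E.

Definition paraproduct_psum b f (F : {fset dyadic}) (x : R) : R :=
  \sum_(J <- F) inner b (haar J) * avg f J * haar J x.

(* [g] is the sum of the series defining the paraproduct: unordered
   convergence in L^2 over the index set of all dyadic intervals. *)
Definition is_paraproduct b f g : Prop :=
  inL2 g /\
  forall e : R, 0 < e -> exists F0 : {fset dyadic}, forall F : {fset dyadic},
    (F0 `<=` F)%fset -> (L2norm (paraproduct_psum b f F \- g)%R < e%:E)%E.

Definition paraproduct_bounded b : Prop :=
  exists C : R, forall f, inHs f ->
    exists g, [/\ is_paraproduct b f g, inHs g &
                  (Hs_norm g <= C%:E * Hs_norm f)%E].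

Definition paraproduct_opnorm b : \bar R :=
  ereal_sup [set Hs_norm g | g in
    [set g | exists f, [/\ inHs f, (Hs_norm f <= 1)%E & is_paraproduct b f g]]].

Definition paraproduct_compact b : Prop :=
  (forall f, inHs f -> exists2 g, is_paraproduct b f g & inHs g) /\
  forall (f g : nat -> R -> R) (M : R),
    (forall n, inHs (f n) /\ (Hs_norm (f n) <= M%:E)%E) ->
    (forall n, is_paraproduct b (f n) (g n)) ->
    exists (phi : nat -> nat) (h : R -> R),
      [/\ {homo phi : m n / (m < n)%N}, inHs h &
          (fun n => Hs_norm (fun x => g (phi n) x - h x)) @ \oo --> 0%E].

End Spaces.

(* Main.v *)
Require Import Defs.
From mathcomp Require Import all_boot all_order all_algebra finmap.
From mathcomp Require Import all_classical all_reals all_analysis measurable_realfun.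
From mathcomp Require Import ring lra.

(** The paraproduct acts diagonally on Haar coefficients: the coefficient of
    the image of f at J is (b,h_J) times the average <f>_J. Since |J| <= 1,
    the squared H^s norm of the image is comparable with the sum over J of
    mu_J <f>_J^2, where mu_J = |J|^(-2s) (b,h_J)^2. Boundedness is thus a
    Carleson embedding for the weights mu, and the theorem says that this
    embedding is characterized by testing on finite unions of dyadic
    intervals, the measure of such a union being its capacity.

    Testing is necessary because a function that is at least 1 on the union
    of the I_k has averages at least 1 on every J inside some I_k
    ([sup_of_embedding]).

    Sufficiency ([carleson_embedding]) is a capacitary strong type
    inequality. Consider the heights lam 2^i, where lam bounds the H^s norm
    of f. The intervals with |<f>_J| > lam 2^i lie inside finitely many
    disjoint stopping intervals, so their total weight is at most the
    capacity of a level set of the dyadic maximal function Mf; this capacity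
    is at most the squared H^s norm of the part of Mf between two
    consecutive heights, divided by the square of their distance. It remains
    to see that the squared norms of all these truncations add up to a
    multiple of lam^2 ([energy_trunc_runmax]). By Abel summation the H^s
    norm is comparable with the weighted sum over generations j of 2^(2sj)
    ||f - E_j f||^2 ([sum_variance_le]; here s > 0 is essential). In ||u -
    E_j u||^2 the conditional expectation may be replaced by any function
    constant on the intervals of generation j ([variance_le]). For a
    truncation of Mf the truncation of the maximum over the ancestors is
    such a function; the squared increments of the truncations then add up
    pointwise ([sum_trunc_sqr]), and what is left is Mf minus its ancestor
    value, which Doob's maximal inequality controls by ||f - E_j f||^2
    ([doob_local]). Everything happens on a finite tree of averages, with
    finite sums.

    For compactness, the embedding constants of the tails (the weights mu_J
    with |J| < 2^-N) tend to 0 if and only if the capacitary suprema of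
    CMO^s do. Small tails give compactness: the averages of a bounded
    sequence have a pointwise cluster point by Tychonoff's theorem, and only
    finitely many generations of averages matter ([inCMOs_compact]).
    Conversely, if the tails were not uniformly small, functions witnessing
    this would have images with norm staying away from 0 on finer and finer
    generations, so no subsequence of the images could converge
    ([compact_uniform_tails]). *)

Set Implicit Arguments.
Unset Strict Implicit.
Unset Printing Implicit Defensive.
Import Order.TTheory GRing.Theory Num.Theory.
Import numFieldNormedType.Exports.

Local Open Scope classical_set_scope.
Local Open Scope ring_scope.

(** * Martingales on the dyadic tree and Doob's inequality *)

Section Mean.
Variable R : realFieldType.
Implicit Types (F G : nat -> R).

(** The integral over [0,1) of the function equal to [F k] on the k-th dyadic
    interval of length 2^-j. *)
Definition mean j F : R := 2 ^- j * \sum_(0 <= k < 2 ^ j) F k.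

Lemma big_nat_double F n :
  \sum_(0 <= k < n.*2) F k = \sum_(0 <= k < n) (F k.*2 + F k.*2.+1).
Proof.
elim: n => [|n IH]; first by rewrite !big_geq.
by rewrite doubleS 2?big_nat_recr //= [RHS]big_nat_recr //= IH addrA.
Qed.

Lemma meanS j F : mean j.+1 F = mean j (fun k => (F k.*2 + F k.*2.+1) / 2).
Proof.
rewrite /mean expnS mul2n big_nat_double -mulr_suml exprS invfM.
by ring.
Qed.

Lemma le_mean j F G : (forall k, (k < 2 ^ j)%N -> F k <= G k) ->
  mean j F <= mean j G.
Proof.
move=> FG; rewrite /mean ler_wpM2l ?invr_ge0 ?exprn_ge0//.
rewrite big_nat_cond [leRHS]big_nat_cond; apply: ler_sum => k.
by rewrite andbT => /andP[_]; apply: FG.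
Qed.

Lemma eq_mean j F G : (forall k, (k < 2 ^ j)%N -> F k = G k) ->
  mean j F = mean j G.
Proof.
by move=> FG; apply/eqP; rewrite eq_le !le_mean // => k /FG ->.
Qed.

Lemma mean_ge0 j F : (forall k, 0 <= F k) -> 0 <= mean j F.
Proof.
by move=> F0; rewrite /mean mulr_ge0 ?invr_ge0 ?exprn_ge0// sumr_ge0.
Qed.

Lemma meanD j F G : mean j (fun k => F k + G k) = mean j F + mean j G.
Proof. by rewrite /mean big_split mulrDr. Qed.

Lemma meanZ j c F : mean j (fun k => c * F k) = c * mean j F.
Proof. by rewrite /mean -mulr_sumr mulrCA. Qed.

Lemma mean_sum j (I : Type) (r : seq I) (F : I -> nat -> R) :
  mean j (fun k => \sum_(i <- r) F i k) = \sum_(i <- r) mean j (F i).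
Proof. by rewrite /mean exchange_big mulr_sumr. Qed.

End Mean.

Section Martingale.
Variable R : realFieldType.
Implicit Types (a y : nat -> nat -> R) (c : nat -> R).

(** [a j k] plays the role of the average over the k-th interval of generation
    j.  All natural numbers k are allowed, also those beyond the unit interval,
    so that no bound on k has to be carried along. *)
Definition martingale a :=
  forall j k, a j k = (a j.+1 k.*2 + a j.+1 k.*2.+1) / 2.

Definition msq a j : R := mean j (fun k => a j k ^+ 2).

(** For the averages of f this is ||E_(j+1) f - E_j f||^2, the sum of the squared
    Haar coefficients of generation j. *)
Definition incr a j : R :=
  mean j (fun k => ((a j.+1 k.*2 - a j.+1 k.*2.+1) / 2) ^+ 2).

Lemma incr_ge0 a j : 0 <= incr a j.
Proof. by apply: mean_ge0 => k; exact: sqr_ge0. Qed.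

(** Orthogonality of martingale differences, that is, the parallelogram law on
    each pair of children. *)
Lemma incrE a j : martingale a -> incr a j = msq a j.+1 - msq a j.
Proof.
move=> ma; apply/eqP; rewrite eq_sym subr_eq; apply/eqP.
rewrite /msq meanS /incr -meanD; apply: eq_mean => k _; rewrite [a j k]ma.
by field.
Qed.

Lemma le_msq a j d : martingale a -> msq a j <= msq a (d + j).
Proof.
move=> ma; elim: d => // d /le_trans; apply.
by rewrite -subr_ge0 addSn -incrE// incr_ge0.
Qed.

Lemma incr_le a j n : martingale a -> (j < n)%N -> incr a j <= msq a n - msq a j.
Proof.
move=> ma jn; rewrite incrE// lerD2r -(subnK jn); exact: le_msq.
Qed.

Definition anc d k := iter d half k.

Lemma ancS d k : anc d.+1 k = anc d k./2.
Proof. by rewrite /anc iterSr. Qed.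

Lemma half_doubleS k : k.*2.+1./2 = k.
Proof. by rewrite -uphalfE uphalf_double. Qed.

Lemma anc_lt d j k : (k < 2 ^ (d + j))%N -> (anc d k < 2 ^ j)%N.
Proof.
elim: d k => // d IH k kd; rewrite ancS; apply: IH.
by rewrite ltn_half_double -mul2n -expnS -addSn.
Qed.

(** Pythagoras: subtracting a function that is constant on the intervals of
    generation j changes none of the increments from generation j on. *)
Lemma meansq_subanc a c j d : martingale a ->
  mean (d + j) (fun k => (a (d + j)%N k - c (anc d k)) ^+ 2) =
  msq a (d + j) - msq a j + mean j (fun k => (a j k - c k) ^+ 2).
Proof.
move=> ma; elim: d => [|d IH]; first by rewrite subrr add0r.
rewrite addSn meanS.
under [LHS]eq_mean do rewrite 2!ancS doubleK half_doubleS.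
transitivity (incr a (d + j) +
   mean (d + j) (fun k => (a (d + j)%N k - c (anc d k)) ^+ 2)).
  rewrite /incr -meanD; apply: eq_mean => k _.
  by rewrite [a (d + j)%N k]ma; field.
by rewrite IH incrE//; ring.
Qed.

(** The conditional expectation is the best approximation by functions of
    generation j.  The freedom in [c] is what lets nonlinear truncations through:
    no formula for the average of a truncated function is needed. *)
Lemma variance_le a c j d : martingale a ->
  msq a (d + j) - msq a j <=
  mean (d + j) (fun k => (a (d + j)%N k - c (anc d k)) ^+ 2).
Proof.
move=> ma; rewrite meansq_subanc// lerDl; apply: mean_ge0 => k; exact: sqr_ge0.
Qed.

(** The dyadic maximal function, as the maximum of |y| over the ancestors. *)
Fixpoint runmax y d k : R :=
  if d is e.+1 then Num.max (runmax y e k./2) `|y d k| else `|y 0 k|.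

Lemma runmax_ge y d k : `|y d k| <= runmax y d k.
Proof. by case: d => //= d; rewrite le_max lexx orbT. Qed.

Lemma runmax_ge0 y d k : 0 <= runmax y d k.
Proof. exact: le_trans (normr_ge0 _) (runmax_ge y d k). Qed.

Lemma runmax_mono y d j k : runmax y j (anc d k) <= runmax y (d + j) k.
Proof.
elim: d k => // d IH k; rewrite ancS addSn /= le_max.
by rewrite (le_trans (IH k./2)) ?lexx.
Qed.

(** Burkholder's function for Doob's L^2 inequality: it dominates
    m^2 - 4 x^2, it is nonpositive when m = |x|, and its expectation decreases
    along the pair (martingale, running maximum). *)
Definition doob_majorant (x m : R) : R := 2 * m ^+ 2 - 4 * m * `|x|.

Lemma doob_majorant_ge x m : m ^+ 2 - 4 * x ^+ 2 <= doob_majorant x m.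
Proof.
rewrite /doob_majorant -(real_normK (num_real x)) -subr_ge0.
rewrite (_ : _ - _ = (m - 2 * `|x|) ^+ 2) ?sqr_ge0//; ring.
Qed.

(** Replacing m by a new maximum |x| does not increase the expression, the
    difference being 2 (m - |x|)^2; so the expression that is concave in x may be
    used on both sides of a step. *)
Lemma doob_majorant_max (x m : R) : doob_majorant x (Num.max m `|x|) <= 2 * m ^+ 2 - 4 * m * `|x|.
Proof.
rewrite /doob_majorant; case: (leP m) => [mx|//]; rewrite -subr_ge0.
have -> : 2 * m ^+ 2 - 4 * m * `|x| - (2 * `|x| ^+ 2 - 4 * `|x| * `|x|) = 2 * (m - `|x|) ^+ 2 by ring.
by rewrite mulr_ge0 ?sqr_ge0.
Qed.

(** The mean of the majorant starts nonpositive at generation j and decreases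
    from one generation to the next, hence stays nonpositive. *)
Lemma doob y j d : martingale y ->
  mean (d + j) (fun k => runmax y d k ^+ 2) <=
  4 * mean (d + j) (fun k => y d k ^+ 2).
Proof.
move=> my.
suff H : mean (d + j) (fun k => doob_majorant (y d k) (runmax y d k)) <= 0.
  rewrite -subr_le0 -mulNr -meanZ -meanD; apply: le_trans H.
  by apply: le_mean => k _; rewrite mulNr doob_majorant_ge.
elim: d => [|d IH].
  rewrite /mean mulr_ge0_le0// ?invr_ge0 ?exprn_ge0//.
  apply: sumr_le0 => k _ /=; rewrite /doob_majorant -mulrA -expr2.
  by rewrite -mulrBl mulr_le0_ge0 ?sqr_ge0//; lra.
apply: le_trans IH; rewrite addSn meanS; apply: le_mean => k _ /=.
rewrite doubleK uphalf_double; set m := runmax y d k.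
have m0 : 0 <= m by exact: runmax_ge0.
have := doob_majorant_max (y d.+1 k.*2) m; have := doob_majorant_max (y d.+1 k.*2.+1) m.
have := ler_normD (y d.+1 k.*2) (y d.+1 k.*2.+1).
rewrite /doob_majorant [y d k]my normrM (@ger0_norm _ 2^-1) ?invr_ge0//.
set u := `|y d.+1 k.*2|; set v := `|y d.+1 k.*2.+1|; set w := `|_ + _|.
move=> wuv H1 H2; rewrite ler_pdivrMr//; apply: (le_trans (lerD H2 H1)).
rewrite -subr_ge0 (_ : _ - _ = 4 * (m * (u + v - w))); last by field.
by rewrite !mulr_ge0// subr_ge0.
Qed.

(** Below an interval of generation j, the maximal function exceeds its value
    at that interval by at most the maximal function of the martingale recentred
    at the average over the interval.  Doob's inequality for the recentred
    martingale gives the L^2 oscillation of a on the right. *)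
Lemma doob_local a j d : martingale a ->
  mean (d + j) (fun k => (runmax a (d + j) k - runmax a j (anc d k)) ^+ 2) <=
  4 * (msq a (d + j) - msq a j).
Proof.
move=> ma.
(* The recentred martingale; its generation 0 is generation j of a. *)
pose y e k := a (e + j)%N k - a j (anc e k).
have my : martingale y.
  move=> e k; rewrite /y 2!ancS doubleK half_doubleS [a (e + j)%N k]ma addSn.
  by field.
have := meansq_subanc (a j) j d ma; rewrite -/y => E.
have <- : mean (d + j) (fun k => y d k ^+ 2) = msq a (d + j) - msq a j.
  rewrite E [X in _ + X](_ : _ = 0) ?addr0//.
  rewrite /mean big1 ?mulr0// => k _; by rewrite subrr expr0n.
apply: le_trans (doob j d my); apply: le_mean => k _.
rewrite lerXn2r ?nnegrE ?runmax_ge0 ?subr_ge0 ?runmax_mono//.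
rewrite lerBlDl; elim: d k {E} => [|d IH] k; first by rewrite lerDl runmax_ge0.
rewrite addSn ancS /= ge_max; apply/andP; split.
  by rewrite (le_trans (IH k./2))// lerD2l le_max lexx.
have -> : a (d + j).+1 k = a j (anc d k./2) + y d.+1 k by rewrite /y ancS addrC subrK.
rewrite (le_trans (ler_normD _ _))// lerD ?runmax_ge//.
Qed.

End Martingale.

(** * Slicing the maximal function *)

Section Truncation.
Variable R : realFieldType.
Implicit Types (t x y : R).

(** The part of x between the heights t and 2t, lowered by t. *)
Definition trunc t x : R := Num.min (Num.max (x - t) 0) t.

Lemma sqr_sum_le (K : nat) (F : nat -> R) : (forall i, 0 <= F i) ->
  \sum_(0 <= i < K) F i ^+ 2 <= (\sum_(0 <= i < K) F i) ^+ 2.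
Proof.
move=> F0; elim: K => [|K IH]; first by rewrite !big_geq// expr0n.
rewrite !big_nat_recr//= sqrrD lerD2r (le_trans IH)// lerDl.
by rewrite mulrn_wge0// mulr_ge0// sumr_ge0.
Qed.

Lemma trunc_homo t x y : x <= y -> trunc t x <= trunc t y.
Proof.
move=> xy; rewrite /trunc le_min !ge_min !lexx !orbT /=.
by rewrite andbT ge_max !le_max lexx lerD2r xy /= orbT.
Qed.

Lemma trunc0 t : 0 <= t -> trunc t 0 = 0.
Proof. by move=> t0; rewrite /trunc sub0r max_r ?oppr_le0// min_l. Qed.

Lemma trunc_max t x : 0 <= t -> 2 * t <= x -> trunc t x = t.
Proof.
move=> t0 tx; rewrite /trunc min_r// le_max; apply/orP; left; lra.
Qed.

Lemma sum_trunc t K x : 0 <= t ->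
  \sum_(0 <= i < K) trunc (t * 2 ^+ i) x =
  Num.min (Num.max (x - t) 0) (t * 2 ^+ K - t).
Proof.
move=> t0; elim: K => [|K IH].
  by rewrite big_geq// expr0 mulr1 subrr min_r// le_max lexx orbT.
rewrite big_nat_recr//= IH /trunc exprS.
have p0 : t <= t * 2 ^+ K by rewrite ler_peMr// exprn_ege1// ler1n.
move: p0; set p := t * 2 ^+ K => p0.
rewrite (_ : t * _ = 2 * p); last by rewrite /p; ring.
rewrite /Num.min /Num.max.
repeat case: ifPn; rewrite -?leNgt; lra.
Qed.

(** The slices between t 2^i and t 2^(i+1) are nondecreasing functions whose sum
    is 1-Lipschitz, and a sum of squares of nonnegative numbers is at most the
    square of their sum. *)
Lemma sum_trunc_sqr t K x y : 0 <= t -> x <= y ->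
  \sum_(0 <= i < K) (trunc (t * 2 ^+ i) y - trunc (t * 2 ^+ i) x) ^+ 2 <=
  (y - x) ^+ 2.
Proof.
move=> t0 xy; have H i : 0 <= trunc (t * 2 ^+ i) y - trunc (t * 2 ^+ i) x.
  by rewrite subr_ge0 trunc_homo.
apply: (le_trans (sqr_sum_le K H)); rewrite lerXn2r ?nnegrE ?sumr_ge0 ?subr_ge0//.
rewrite sumrB !sum_trunc//.
have p0 : t <= t * 2 ^+ K by rewrite ler_peMr// exprn_ege1// ler1n.
move: p0; set p := t * 2 ^+ K => p0.
by rewrite /Num.min /Num.max; repeat case: ifPn; rewrite -?leNgt; lra.
Qed.

End Truncation.

Section TruncatedMaximal.
Variables (R : realFieldType) (q : R).
Hypothesis q1 : 1 < q.
Implicit Types (a v : nat -> nat -> R).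

(** The squared H^s norm of a function of generation n whose averages are [a],
    where q = 2^(2s). *)
Definition energy a n : R := \sum_(0 <= j < n) q ^+ j * incr a j + msq a n.

Let q0 : 0 < q. Proof. exact: lt_trans q1. Qed.

(** Summation by parts: the variance at generation j is the sum of the later
    increments, and each increment is collected with the weights of all earlier
    generations, a geometric sum dominated by its last term as q > 1. *)
Lemma sum_variance_le a n : martingale a ->
  (q - 1) * \sum_(0 <= j < n) q ^+ j * (msq a n - msq a j) <=
  q * \sum_(0 <= j < n) q ^+ j * incr a j.
Proof.
move=> ma.
suff H m : q * \sum_(0 <= j < m) q ^+ j * incr a j =
    (q - 1) * (\sum_(0 <= j < m) q ^+ j * (msq a n - msq a j)) +
    (msq a n - msq a 0) - q ^+ m * (msq a n - msq a m).
  rewrite H subrr mulr0 subr0 lerDl subr_ge0.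
  by have := le_msq 0 n ma; rewrite addn0.
elim: m => [|m IH]; first by rewrite !big_geq// expr0; ring.
by rewrite !big_nat_recr//= mulrDr IH incrE// exprS; ring.
Qed.

Lemma energy_le_variance a n : martingale a ->
  energy a n <= \sum_(0 <= j < n) q ^+ j * (msq a n - msq a j) + msq a n.
Proof.
move=> ma; rewrite lerD2r big_nat_cond [leRHS]big_nat_cond; apply: ler_sum => j.
rewrite andbT => /andP[_ jn]; rewrite ler_wpM2l ?exprn_ge0 ?(ltW q0)//.
exact: incr_le.
Qed.

(** The strong type estimate on a finite tree: the energies of all slices of the
    maximal function are summable.  Each variance is compared with the
    oscillation around the slice of the ancestor's maximum; with this choice the
    slices can be summed pointwise before Doob's inequality is applied. *)
Lemma energy_trunc_runmax v (u : nat -> nat -> nat -> R) n K t : 0 <= t ->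
  martingale v -> (forall i, martingale (u i)) ->
  (forall i k, (k < 2 ^ n)%N -> u i n k = trunc (t * 2 ^+ i) (runmax v n k)) ->
  \sum_(0 <= i < K) energy (u i) n <= 4 * (q / (q - 1)) * energy v n.
Proof.
move=> t0 mv mu uE; have q10 : 0 < q - 1 by rewrite subr_gt0.
have qq : 1 <= q / (q - 1) by rewrite ler_pdivlMr// mul1r gerBl.
have V : \sum_(0 <= i < K) energy (u i) n <=
    \sum_(0 <= j < n) q ^+ j * (4 * (msq v n - msq v j)) + 4 * msq v n.
  apply: le_trans (ler_sum _ (fun i _ => energy_le_variance n (mu i))) _.
  rewrite big_split /=; apply: lerD.
    rewrite exchange_big /= big_nat_cond [leRHS]big_nat_cond.
    apply: ler_sum => j; rewrite andbT => /andP[_ jn].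
    rewrite -mulr_sumr ler_wpM2l ?exprn_ge0 ?(ltW q0)//.
    have [d dn] : exists d, (d + j)%N = n by exists (n - j)%N; rewrite subnK// ltnW.
    have := doob_local j d mv; rewrite dn; apply: le_trans.
    have V i := variance_le (fun k => trunc (t * 2 ^+ i) (runmax v j k)) j d (mu i).
    rewrite dn in V; apply: le_trans (ler_sum _ (fun i _ => V i)) _.
    rewrite -mean_sum; apply: le_mean => k kn.
    under eq_bigr do rewrite uE//.
    by apply: sum_trunc_sqr => //; rewrite -dn; exact: runmax_mono.
  have := doob 0 n mv; rewrite addn0 -mean_sum => D; apply: le_trans D.
  apply: le_mean => k kn; under eq_bigr do rewrite uE//.
  have := @sum_trunc_sqr _ t K 0 (runmax v n k) t0 (runmax_ge0 _ _ _).
  rewrite subr0; apply: le_trans; apply: ler_sum => i _.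
  by rewrite trunc0 ?subr0// mulr_ge0// exprn_ge0.
apply: (le_trans V); under eq_bigr do rewrite mulrCA.
rewrite -mulr_sumr -mulrDr -mulrA ler_wpM2l//.
rewrite /energy mulrDr lerD//; last first.
  by rewrite ler_peMl// mean_ge0// => k; exact: sqr_ge0.
have := sum_variance_le n mv.
by rewrite -ler_pdivlMl// mulrA [_^-1 * _]mulrC.
Qed.

End TruncatedMaximal.

(** * Square-integrable functions on the unit interval *)

Section L2.
Variable R : realType.
Implicit Types (f g h : R -> R).
Local Notation mu := (leb R).
Local Notation I0 := (@I0 R).

Definition l2sq f : R := \int[mu]_(x in I0) (f x ^+ 2).

Lemma measurable_I0 : measurable (I0 : set (measurableTypeR R)).
Proof. exact: measurable_itv. Qed.

Lemma inL2_mul f g : inL2 f -> inL2 g -> mu.-integrable I0 (EFin \o (f \* g)).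
Proof.
move=> f2 g2; rewrite integrable_mkcond; last exact: measurable_I0.
have := Lfun2_mul_Lfun1 f2 g2 => /Lfun1_integrable; apply: eq_integrable => // x _.
by rewrite /= !patchE; case: ifP => //=; rewrite mul0r.
Qed.

Lemma inL2_sqr f : inL2 f -> mu.-integrable I0 (fun x => (f x ^+ 2)%:E).
Proof. by move=> f2; exact: (inL2_mul f2 f2). Qed.

Lemma inL2_meas f : inL2 f -> measurable_fun I0 f.
Proof.
move=> /andP[]; rewrite !inE/= => mf _.
by apply/(measurable_restrictT _ measurable_I0).
Qed.

Lemma L2normE f : (L2norm f ^+ 2 = \int[mu]_(x in I0) (f x ^+ 2)%:E)%E.
Proof.
rewrite /L2norm unlock.
set J := (\int[_]_x _)%E.
have -> : J = (\int[mu]_(x in I0) (f x ^+ 2)%:E)%E.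
  rewrite [RHS]integral_mkcond; apply: eq_integral => x _ /=.
  rewrite !patchE powR_mulrn ?normr_ge0//; case: ifP => _ //=.
    by rewrite real_normK ?num_real.
  by rewrite normr0 expr0n.
rewrite poweR12_sqrt ?sqr_sqrte//; apply: integral_ge0 => x _;
  by rewrite lee_fin sqr_ge0.
Qed.

Lemma inL2P f : measurable_fun I0 f ->
  mu.-integrable I0 (fun x => (f x ^+ 2)%:E) -> inL2 f.
Proof.
move=> mf f2; apply/andP; split; rewrite !inE/=.
  by apply/(measurable_restrictT _ measurable_I0).
have : (L2norm f ^+ 2 < +oo)%E.
  rewrite L2normE; exact: (integrable_lty measurable_I0 f2).
rewrite /finite_norm -/(L2norm f) !ltey; apply: contra => /eqP fy.
by have -> : L2norm f = +oo%E by []; rewrite expe2 mulyy.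
Qed.

Lemma L2norm_sqr f : inL2 f -> (L2norm f ^+ 2 = (l2sq f)%:E)%E.
Proof.
move=> f2; rewrite L2normE /l2sq /Rintegral fineK//.
exact: (integrable_fin_num measurable_I0 (inL2_sqr f2)).
Qed.

Lemma L2norm_ge0 f : (0 <= L2norm f)%E.
Proof. exact: Lnorm_ge0. Qed.

Lemma l2sq_ge0 f : 0 <= l2sq f.
Proof. by apply: Rintegral_ge0 => x _; exact: sqr_ge0. Qed.

Lemma L2norm_lt f e : inL2 f -> 0 < e -> (L2norm f < e%:E)%E = (l2sq f < e ^+ 2).
Proof.
move=> f2 e0; have := L2norm_sqr f2; have := L2norm_ge0 f.
case: (L2norm f) => [r||//]; last by move=> _; rewrite expe2 mulyy.
rewrite !lee_fin lte_fin -EFin_expe => r0 [] <-; rewrite ltr_pXn2r ?nnegrE//; exact: ltW.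
Qed.

Lemma inL2D f g : inL2 f -> inL2 g -> inL2 (f \+ g).
Proof.
rewrite /inL2 => f2 g2.
have -> : (f \+ g) \_ I0 = (f \_ I0) + (g \_ I0).
  by apply/funext => x; rewrite patchE !fctE !patchE; case: ifP; rewrite ?addr0.
have p1 : (1 <= 2%:E :> \bar R)%E by rewrite lee1n.
by have [_] := Lfun_addr_closed mu p1; exact.
Qed.

Lemma inL2Z c f : inL2 f -> inL2 (fun x => c * f x).
Proof.
rewrite /inL2 => f2.
have -> : (fun x => c * f x) \_ I0 = c \o* (f \_ I0).
  apply/funext => x; rewrite /= !patchE; case: ifP => _; rewrite ?mul0r//.
  by rewrite mulrC.
by apply: Lfun_scale => //; rewrite ler1n.
Qed.

Lemma inL2B f g : inL2 f -> inL2 g -> inL2 (f \- g).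
Proof.
move=> f2 g2; have -> : f \- g = f \+ (fun x => (-1) * g x).
  by apply/funext => x /=; rewrite mulN1r.
by apply: inL2D => //; exact: inL2Z.
Qed.

Lemma inL2_eq f g : (forall x, I0 x -> f x = g x) -> inL2 f -> inL2 g.
Proof.
move=> fg; rewrite /inL2; have -> // : f \_ I0 = g \_ I0.
by apply/funext => x; rewrite !patchE; case: ifP => //; rewrite inE => /fg.
Qed.

Lemma mu_I0_lty : (mu I0 < +oo)%E.
Proof. by rewrite lebesgue_measure_itv /= lte_fin ltr01 -EFinB ltry. Qed.

Lemma inL2_bounded f M : measurable_fun I0 f -> (forall x, `|f x| <= M) -> inL2 f.
Proof.
move=> mf fM; apply: inL2P => //.
have M0 : 0 <= M by apply: le_trans (fM 0).
apply: (@le_integrable _ _ _ _ _ measurable_I0 _ (EFin \o cst (M ^+ 2))).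
- by apply/measurable_EFinP; exact: measurable_funX.
- move=> x _ /=; rewrite lee_fin !normrX (ger0_norm M0).
  by rewrite lerXn2r ?nnegrE.
- apply: measurable_bounded_integrable measurable_I0 mu_I0_lty _ _ => //.
  exact: bounded_cst.
Qed.

Lemma inL2_int f : inL2 f -> mu.-integrable I0 (EFin \o f).
Proof.
move=> f2; have i1 : inL2 (cst 1 : R -> R).
  by apply: (@inL2_bounded _ 1) => // x; rewrite normr1.
have := inL2_mul f2 i1; apply: eq_integrable; first exact: measurable_I0.
by move=> x _ /=; rewrite mulr1.
Qed.

Lemma innerDl f g h : inL2 f -> inL2 g -> inL2 h ->
  inner (f \+ g) h = inner f h + inner g h.
Proof.
move=> f2 g2 h2; rewrite /inner -(RintegralD measurable_I0 (inL2_mul f2 h2) (inL2_mul g2 h2)).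
by apply: eq_Rintegral => x _; rewrite mulrDl.
Qed.

Lemma innerZl c f h : inL2 f -> inL2 h ->
  inner (fun x => c * f x) h = c * inner f h.
Proof.
move=> f2 h2; rewrite /inner -(RintegralZl c measurable_I0 (inL2_mul f2 h2)).
by apply: eq_Rintegral => x _; rewrite mulrA.
Qed.

Lemma innerC f g : inner f g = inner g f.
Proof. by apply: eq_Rintegral => x _; rewrite mulrC. Qed.

Lemma innerBl f g h : inL2 f -> inL2 g -> inL2 h ->
  inner (f \- g) h = inner f h - inner g h.
Proof.
move=> f2 g2 h2; rewrite -[- inner g h]mulN1r -innerZl// -innerDl//; last exact: inL2Z.
by apply: eq_Rintegral => x _ /=; rewrite mulN1r.
Qed.

Lemma l2sqE f : l2sq f = inner f f.
Proof. by []. Qed.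

Lemma l2sqD f g : inL2 f -> inL2 g ->
  l2sq (f \+ g) = l2sq f + 2 * inner f g + l2sq g.
Proof.
move=> f2 g2; have fg := inL2D f2 g2.
rewrite !l2sqE innerDl// ![inner _ (_ \+ _)]innerC !innerDl// (innerC g f); ring.
Qed.

Lemma l2sqZ c f : inL2 f -> l2sq (fun x => c * f x) = c ^+ 2 * l2sq f.
Proof.
move=> f2; have := inL2Z c f2 => cf; rewrite !l2sqE innerZl// innerC innerZl// expr2 mulrA.
by [].
Qed.

(** The parallelogram law; it replaces the triangle inequality throughout,
    since constants are immaterial. *)
Lemma l2sqD_le f g : inL2 f -> inL2 g ->
  l2sq (f \+ g) <= 2 * l2sq f + 2 * l2sq g.
Proof.
move=> f2 g2; have := l2sq_ge0 (f \- g).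
have -> : f \- g = f \+ (fun x => (-1) * g x).
  by apply/funext => x /=; rewrite mulN1r.
have ng := inL2Z (-1) g2.
rewrite !l2sqD// l2sqZ// innerC innerZl// innerC; lra.
Qed.

Lemma l2sqB_le f g : inL2 f -> inL2 g ->
  l2sq (f \- g) <= 2 * l2sq f + 2 * l2sq g.
Proof.
move=> f2 g2; have ng := inL2Z (-1) g2; have := l2sqD_le f2 ng.
rewrite l2sqZ// sqrrN expr1n mul1r; congr (_ <= _); apply: eq_Rintegral => x _ /=.
by rewrite mulN1r.
Qed.

End L2.

Arguments measurable_I0 {R} i _.

(** * Dyadic intervals, averages and Haar functions *)

Section DyadicIntervals.
Variable R : realType.
Implicit Types (j k l m d : nat) (x : R) (I J : dyadic).
Local Notation mu := (leb R).

Definition dint j k : set R :=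
  `[k%:R * (2 ^- j), k.+1%:R * (2 ^- j)[%classic.

Lemma dintP j k x : dint j k x <-> k%:R <= x * 2 ^+ j < k.+1%:R.
Proof.
rewrite /dint /= in_itv /=.
by rewrite ler_pdivrMr ?exprn_gt0// ltr_pdivlMr ?exprn_gt0.
Qed.

Lemma dintE I : dset R I = dint (tag I) (tagged I).
Proof. by []. Qed.

Lemma dint_split j k : dint j k = dint j.+1 k.*2 `|` dint j.+1 k.*2.+1.
Proof.
apply/seteqP; split => x; rewrite /= !dintP exprS -muln2 -!natr1 !natrM mulrCA.
set y := x * _; set u := k%:R : R.
  move=> /andP[h1 h2].
  by case: (ltP (2 * y) (u * 2 + 1)) => H; [left|right]; apply/andP; split; lra.
by case=> /andP[h1 h2]; apply/andP; split; lra.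
Qed.

Lemma dint_inj j k l x : dint j k x -> dint j l x -> k = l.
Proof.
move=> /dintP/andP[h1 h2] /dintP/andP[h3 h4]; apply/eqP; rewrite eqn_leq.
have := le_lt_trans h1 h4; have := le_lt_trans h3 h2.
by rewrite !ltr_nat !ltnS => -> ->.
Qed.

Lemma dint_half j k : dint j.+1 k `<=` dint j k./2.
Proof.
move=> x; rewrite [dint j k./2]dint_split -{1}[k]odd_double_half.
by case: (odd k); rewrite ?add1n ?add0n; [right|left].
Qed.

Lemma dint_anc d j k : dint (d + j) k `<=` dint j (anc d k).
Proof.
elim: d k => [|d IH] k x; first exact: id.
by rewrite addSn ancS => xk; exact/IH/dint_half.
Qed.

Lemma dint_anc_eq d j k l x : dint j k x -> dint (d + j) l x -> anc d l = k.
Proof. by move=> xk /dint_anc; move/dint_inj; apply. Qed.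

Lemma dint_nonempty j k : dint j k (k%:R * 2 ^- j).
Proof.
by apply/dintP; rewrite divfK ?expf_neq0// lexx ltr_nat ltnS leqnn.
Qed.

Lemma measurable_dint j k : measurable (dint j k : set (measurableTypeR R)).
Proof. exact: measurable_itv. Qed.

Lemma mu_dint j k : mu (dint j k) = (2 ^- j)%:E.
Proof.
rewrite lebesgue_measure_itv /= lte_fin.
rewrite ltr_pM2r ?invr_gt0 ?exprn_gt0// ltr_nat ltnSn.
by rewrite -EFinB -mulrBl -natr1 [_ + 1]addrC addrK mul1r.
Qed.

Lemma dint_sub_I0 j k : (k < 2 ^ j)%N -> dint j k `<=` @I0 R.
Proof.
move=> kj x /dintP/andP[h1 h2]; rewrite /I0 /= in_itv /=.
have p : 0 < 2 ^+ j :> R by rewrite exprn_gt0.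
apply/andP; split.
  by rewrite -(pmulr_lge0 _ p) (le_trans _ h1).
rewrite -(ler_pM2r p) mul1r (le_trans (ltW h2))//.
by rewrite -natrX ler_nat.
Qed.

Lemma dint_exists j x : 0 <= x -> x < 1 -> exists2 k, (k < 2 ^ j)%N & dint j k x.
Proof.
move=> x0 x1; elim: j => [|j [k kj]].
  by exists 0%N => //; apply/dintP; rewrite expr0 mulr1 x0 x1.
rewrite dint_split => -[] xk; [exists k.*2|exists k.*2.+1] => //.
  by rewrite expnS mul2n ltn_double.
by rewrite expnS mul2n ltn_Sdouble.
Qed.

Lemma dleftE I : (dleft I : set R) = dint (tag I).+1 (tagged I).*2.
Proof.
have p : 2 ^+ tag I != 0 :> R by rewrite expf_neq0.
rewrite /dleft /dint /dlen -[(_.*2.+1)%:R]natr1 -muln2 natrM exprS.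
have -> : (tagged I)%:R * 2 * (2 * 2 ^+ tag I)^-1 = (tagged I)%:R * 2 ^- tag I :> R by field.
suff -> : ((tagged I)%:R + 2^-1) * 2 ^- tag I =
  ((tagged I)%:R * 2 + 1) * (2 * 2 ^+ tag I)^-1 :> R by [].
by field.
Qed.

Lemma drightE I : (dright I : set R) = dint (tag I).+1 (tagged I).*2.+1.
Proof.
have p : 2 ^+ tag I != 0 :> R by rewrite expf_neq0.
rewrite /dright /dint /dlen -[(_.*2.+2)%:R]natr1 -[(_.*2.+1)%:R]natr1.
rewrite -[(tagged I).+1%:R]natr1 -muln2 natrM exprS.
have -> : ((tagged I)%:R * 2 + 1) * (2 * 2 ^+ tag I)^-1 =
  ((tagged I)%:R + 2^-1) * 2 ^- tag I :> R by field.
suff -> : ((tagged I)%:R * 2 + 1 + 1) * (2 * 2 ^+ tag I)^-1 =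
  ((tagged I)%:R + 1) * 2 ^- tag I :> R by [].
by field.
Qed.

End DyadicIntervals.

Arguments dint R j k : clear implicits.
Arguments measurable_dint {R} j k i _.

Section Averages.
Variable R : realType.
Implicit Types (j k l m d : nat) (x : R) (I J : dyadic) (f g h : R -> R).
Implicit Types (w : nat -> R) (c : dyadic -> R).
Local Notation mu := (leb R).
Local Notation I0 := (@I0 R).

(** The function is cut off outside the unit interval so that its averages form
    a martingale for every index k. *)
Definition avg_tree f j k : R := (2 ^- j)^-1 * \int[mu]_(x in dint R j k) (f \_ I0) x.

Lemma Rint_patch f (A : set R) : A `<=` I0 ->
  \int[mu]_(x in A) (f \_ I0) x = \int[mu]_(x in A) f x.
Proof.
by move=> AI; apply: eq_Rintegral => x; rewrite inE => /AI xI; rewrite patchE mem_set.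
Qed.

Lemma avgE f I : avg f I = avg_tree f (tag I) (tagged I).
Proof. by rewrite /avg_tree Rint_patch//; apply: dint_sub_I0; exact: ltn_ord. Qed.

Lemma inL2_patch_int f (A : set (measurableTypeR R)) : measurable A -> inL2 f ->
  mu.-integrable A (EFin \o (f \_ I0)).
Proof.
move=> mA f2; apply: (@integrableS _ _ _ _ setT) => //.
have := inL2_int f2; rewrite (integrable_mkcond _ measurable_I0).
by rewrite -restrict_EFin.
Qed.

Lemma martingale_avg_tree f : inL2 f -> martingale (avg_tree f).
Proof.
move=> f2 j k; rewrite /avg_tree dint_split Rintegral_setU.
- by rewrite exprS !invfM; field; rewrite expf_neq0.
- exact: measurable_dint.
- exact: measurable_dint.
- by apply: inL2_patch_int => //; apply: measurableU; exact: measurable_dint.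
- rewrite disj_set2E; apply/eqP/seteqP; split => // x [/= h1 h2].
  by have /eqP := dint_inj h1 h2; rewrite -addn1 -{1}[k.*2]addn0 eqn_add2l.
Qed.

Lemma avg_tree_cst f j k (e : R) : (k < 2 ^ j)%N -> (forall x, dint R j k x -> f x = e) ->
  avg_tree f j k = e.
Proof.
move=> kj fe; rewrite /avg_tree Rint_patch; last exact: dint_sub_I0.
rewrite (@eq_Rintegral _ _ _ mu _ (cst e)); last by move=> x; rewrite inE => /fe.
rewrite Rintegral_cst; last exact: measurable_dint.
by rewrite [fine _](congr1 fine (mu_dint _ j k)) /= mulrCA mulVf ?mulr1// invr_eq0 expf_neq0.
Qed.

Lemma inL2_indic (A : set (measurableTypeR R)) : measurable A -> inL2 (\1_A : R -> R).
Proof.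
move=> mA; apply: (@inL2_bounded _ _ 1).
  exact: measurable_indic.
by move=> x; rewrite indicE; case: (_ \in _); rewrite ?normr1 ?normr0.
Qed.

Lemma inner_indic f (A : set (measurableTypeR R)) : measurable A -> A `<=` I0 ->
  inner f \1_A = \int[mu]_(x in A) f x.
Proof.
move=> mA AI; rewrite /inner -[A in RHS](setIidr AI) Rintegral_mkcondr.
apply: eq_Rintegral => x _; rewrite patchE indicE.
by case: (x \in A); rewrite ?mulr1 ?mulr0.
Qed.

Lemma inner_dint f j k : (k < 2 ^ j)%N -> inner f \1_(dint R j k) = 2 ^- j * avg_tree f j k.
Proof.
move=> kj; rewrite inner_indic; last 2 first.
- exact: measurable_dint.
- exact: dint_sub_I0.
rewrite /avg_tree Rint_patch; last exact: dint_sub_I0.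
by rewrite mulrA divff ?mul1r// invr_eq0 expf_neq0.
Qed.

Lemma inL2_dint j k : inL2 (\1_(dint R j k) : R -> R).
Proof. by apply: inL2_indic; exact: measurable_dint. Qed.

Lemma ltn_children j k : (k < 2 ^ j)%N ->
  (k.*2 < 2 ^ j.+1)%N /\ (k.*2.+1 < 2 ^ j.+1)%N.
Proof. by move=> kj; rewrite expnS mul2n ltn_double ltn_Sdouble. Qed.

Lemma haarE I : haar I = fun x => dlen R I `^ (- 2^-1) *
  ((\1_(dint R (tag I).+1 (tagged I).*2) : R -> R) \-
   \1_(dint R (tag I).+1 (tagged I).*2.+1)) x.
Proof. by apply/funext => x; rewrite /haar dleftE drightE. Qed.

Lemma inL2_haar I : inL2 (haar I : R -> R).
Proof.
by rewrite haarE; apply: inL2Z; apply: inL2B; exact: inL2_dint.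
Qed.

(** Pairing with the Haar function of I only sees the averages over the two
    children of I. *)
Lemma inner_haar f I : inL2 f -> inner f (haar I) = dlen R I `^ (- 2^-1) *
  (2 ^- (tag I).+1 * (avg_tree f (tag I).+1 (tagged I).*2 - avg_tree f (tag I).+1 (tagged I).*2.+1)).
Proof.
move=> f2; have [kl kr] := ltn_children (ltn_ord (tagged I)).
rewrite haarE innerC innerZl//; last by apply: inL2B; exact: inL2_dint.
rewrite innerBl//; try exact: inL2_dint.
by rewrite ![inner \1__ _]innerC !inner_dint// -mulrBr.
Qed.

Lemma dlen_gt0 I : 0 < dlen R I.
Proof. by rewrite /dlen invr_gt0 exprn_gt0. Qed.

Lemma sqr_powRN2 (e : R) : 0 < e -> (e `^ (- 2^-1)) ^+ 2 = e^-1.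
Proof.
move=> e0; rewrite -powR_mulrn ?powR_ge0// -powRrM.
by rewrite mulNr mulVf// powR_inv1// ltW.
Qed.

Lemma inner_haar_sqr f I : inL2 f -> (inner f (haar I)) ^+ 2 =
  2 ^- (tag I) * ((avg_tree f (tag I).+1 (tagged I).*2 - avg_tree f (tag I).+1 (tagged I).*2.+1) / 2) ^+ 2.
Proof.
move=> f2; rewrite inner_haar// exprMn sqr_powRN2 ?dlen_gt0// /dlen invrK [2 ^+ _.+1]exprS.
by field; rewrite expf_neq0.
Qed.

Lemma inL2_lin (T : Type) (r : seq T) (c : T -> R) (F : T -> R -> R) :
  (forall i, inL2 (F i)) -> inL2 (fun x => \sum_(i <- r) c i * F i x).
Proof.
move=> F2; elim: r => [|i r IH].
  apply: (@inL2_bounded _ _ 0).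
    by under eq_fun do rewrite big_nil; exact: measurable_cst.
  by move=> x; rewrite big_nil normr0.
apply: (inL2_eq _ (inL2D (inL2Z (c i) (F2 i)) IH)) => x _ /=.
by rewrite big_cons.
Qed.

Lemma inner_lin (T : Type) (r : seq T) (c : T -> R) (F : T -> R -> R) h :
  (forall i, inL2 (F i)) -> inL2 h ->
  inner (fun x => \sum_(i <- r) c i * F i x) h = \sum_(i <- r) c i * inner (F i) h.
Proof.
move=> F2 h2; elim: r => [|i r IH].
  rewrite big_nil /inner (@eq_Rintegral _ _ _ mu _ (cst 0)); last first.
    by move=> x _; rewrite big_nil mul0r.
  by rewrite Rintegral_cst ?mul0r//; exact: measurable_I0.
rewrite big_cons -IH -(innerZl (c i) (F2 i) h2) -innerDl//; first last.
- exact: inL2_lin.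
- exact: inL2Z.
by apply: eq_Rintegral => x _ /=; rewrite big_cons.
Qed.

(** Step functions of generation n are the test functions for capacities. *)
Definition stepf n w x : R := \sum_(0 <= l < 2 ^ n) w l * \1_(dint R n l) x.

Lemma inL2_stepf n w : inL2 (stepf n w).
Proof. by apply: inL2_lin => l; exact: inL2_dint. Qed.

Lemma stepfE n w l x : (l < 2 ^ n)%N -> dint R n l x -> stepf n w x = w l.
Proof.
move=> ln xl; rewrite /stepf (bigD1_seq l) ?mem_index_iota ?iota_uniq//=.
rewrite indicE mem_set// mulr1 big1 ?addr0// => m ml.
rewrite indicE memNset ?mulr0// => xm; move/eqP: ml; apply.
exact: dint_inj xm xl.
Qed.

Lemma avg_tree_stepf n w l : (l < 2 ^ n)%N -> avg_tree (stepf n w) n l = w l.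
Proof. by move=> ln; apply: avg_tree_cst => // x; exact: stepfE. Qed.

Lemma inner_stepf f n w : inL2 f ->
  inner f (stepf n w) = mean n (fun l => w l * avg_tree f n l).
Proof.
move=> f2; rewrite innerC /stepf inner_lin//; last by move=> l; exact: inL2_dint.
rewrite /mean mulr_sumr big_nat_cond [RHS]big_nat_cond; apply: eq_bigr => l.
rewrite andbT => /andP[_ ln]; rewrite innerC inner_dint//; ring.
Qed.

Lemma l2sq_stepf n w : l2sq (stepf n w) = mean n (fun l => w l ^+ 2).
Proof.
rewrite l2sqE inner_stepf; last exact: inL2_stepf.
by apply: eq_mean => l ln; rewrite avg_tree_stepf// expr2.
Qed.

(** Bessel's inequality, from expanding ||f - E_j f||^2 >= 0. *)
Lemma msq_le_l2sq f j : inL2 f -> msq (avg_tree f) j <= l2sq f.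
Proof.
move=> f2; have s2 := inL2_stepf j (avg_tree f j).
have := l2sq_ge0 (f \+ (fun x => (-1) * stepf j (avg_tree f j) x)).
rewrite l2sqD//; last exact: inL2Z.
rewrite l2sqZ// innerC innerZl// innerC inner_stepf// l2sq_stepf.
have -> : mean j (fun l => avg_tree f j l * avg_tree f j l) = msq (avg_tree f) j.
  by apply: eq_mean => l _; rewrite expr2.
rewrite -/(msq _ j); lra.
Qed.

Lemma haar_sum_incr f j : inL2 f ->
  \sum_(k < 2 ^ j) (inner f (haar (Tagged (fun j => 'I_(2 ^ j)) k))) ^+ 2
  = incr (avg_tree f) j.
Proof.
move=> f2; rewrite /incr /mean mulr_sumr big_mkord; apply: eq_bigr => k _.
by rewrite inner_haar_sqr.
Qed.

Lemma inner_haar_le f I : inL2 f -> (inner f (haar I)) ^+ 2 <= l2sq f.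
Proof.
move=> f2; case: I => j k; apply: le_trans (msq_le_l2sq j.+1 f2).
have : incr (avg_tree f) j <= msq (avg_tree f) j.+1.
  rewrite incrE; last exact: martingale_avg_tree.
  by rewrite gerBl mean_ge0// => l; exact: sqr_ge0.
apply: le_trans; rewrite -haar_sum_incr// (bigD1 k)//= lerDl.
by apply: sumr_ge0 => l _; exact: sqr_ge0.
Qed.

Lemma avg_le f I : inL2 f -> (avg f I) ^+ 2 <= 2 ^+ (tag I) * l2sq f.
Proof.
move=> f2; rewrite -ler_pdivrMl ?exprn_gt0// avgE.
apply: le_trans (msq_le_l2sq (tag I) f2).
rewrite /msq /mean ler_wpM2l ?invr_ge0 ?exprn_ge0// big_mkord.
rewrite (bigD1 (tagged I))//= lerDl.
by apply: sumr_ge0 => l _; exact: sqr_ge0.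
Qed.

Lemma haar_dint I m x : dint R (tag I).+1 m x -> haar I x = dlen R I `^ (- 2^-1) *
  ((m == (tagged I).*2)%:R - (m == (tagged I).*2.+1)%:R).
Proof.
move=> xm; rewrite haarE /= !indicE; congr (_ * (_%:R - _%:R)); congr nat_of_bool.
  by apply/idP/eqP => [|<-]; rewrite inE// => /(dint_inj xm).
by apply/idP/eqP => [|<-]; rewrite inE// => /(dint_inj xm).
Qed.

Lemma haar_cst I J : (tag I < tag J)%N ->
  exists e, forall x, dint R (tag J) (tagged J) x -> haar I x = e.
Proof.
move=> IJ; exists (dlen R I `^ (- 2^-1) *
  ((anc (tag J - (tag I).+1) (tagged J) == (tagged I).*2)%:R
   - (anc (tag J - (tag I).+1) (tagged J) == (tagged I).*2.+1)%:R)).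
by move=> x; rewrite -{1}(subnK IJ) => /dint_anc /haar_dint.
Qed.

(** By symmetry let I be at least as long as J.  If I is strictly longer, its
    Haar function is constant on J, so that its averages over the children of J
    coincide. *)
Lemma haar_orthonormal I J : inner (haar I : R -> R) (haar J) = (I == J)%:R.
Proof.
wlog IJ : I J / (tag I <= tag J)%N.
  by move=> H; case: (leqP (tag I) (tag J)) => [/H//|/ltnW/H E]; rewrite innerC eq_sym.
rewrite inner_haar; last exact: inL2_haar.
have [kl kr] := ltn_children (ltn_ord (tagged J)).
have [tIJ|tIJ] := eqVneq (tag I) (tag J); last first.
  have -> : (I == J) = false by apply/eqP => E; rewrite E eqxx in tIJ.
  have {tIJ}IJ' : (tag I < tag J)%N by rewrite ltn_neqAle tIJ.
  have [e He] := haar_cst IJ'.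
  rewrite (@avg_tree_cst _ _ _ e)//; last by move=> x xl; apply: He; rewrite dint_split; left.
  rewrite (@avg_tree_cst _ _ _ e)//; last by move=> x xl; apply: He; rewrite dint_split; right.
  by rewrite subrr !mulr0.
rewrite (avg_tree_cst kl (e := dlen R I `^ (- 2^-1) *
  (((tagged J).*2 == (tagged I).*2)%:R - ((tagged J).*2 == (tagged I).*2.+1)%:R))); last first.
  by move=> x xl; rewrite (@haar_dint _ (tagged J).*2)// tIJ.
rewrite (avg_tree_cst kr (e := dlen R I `^ (- 2^-1) *
  (((tagged J).*2.+1 == (tagged I).*2)%:R - ((tagged J).*2.+1 == (tagged I).*2.+1)%:R))); last first.
  by move=> x xl; rewrite (@haar_dint _ (tagged J).*2.+1)// tIJ.
rewrite (_ : (_.*2 == _.*2.+1) = false); last first.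
  by apply/eqP => /(congr1 odd); rewrite oddS !odd_double.
rewrite (_ : (_.*2.+1 == _.*2) = false); last first.
  by apply/eqP => /(congr1 odd); rewrite oddS !odd_double.
rewrite eqSS -!muln2 eqn_pmul2r// subr0 sub0r.
have -> : (I == J) = (tagged J == tagged I :> nat).
  apply/eqP/eqP => [->//|].
  case: I J tIJ {IJ kl kr} => [i k] [j l] /= ij; subst j => /val_inj -> //.
case: eqP => _; last by rewrite /= !mulr0n oppr0 subrr !mulr0.
have -> : dlen R I = dlen R J by rewrite /dlen tIJ.
rewrite /= mulr1n mulrN opprK mulr1.
have := sqr_powRN2 (dlen_gt0 J); rewrite {2}/dlen invrK; set e := _ `^ _ => E.
have -> : e * (2 ^- (tag J).+1 * (e + e)) = e ^+ 2 * (2 * 2 ^- (tag J).+1) by ring.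
by rewrite E [2 ^+ _.+1]exprS; field; rewrite expf_neq0.
Qed.

End Averages.

(** * Haar series *)

Section Levels.
Implicit Types (I J : dyadic) (n : nat).

Definition level j : seq dyadic :=
  [seq Tagged (fun j => 'I_(2 ^ j)) k | k <- enum 'I_(2 ^ j)].

(** These finite families are cofinal among the finite sets of intervals, so
    that all sums of nonnegative terms over the dyadic intervals can be
    controlled along them. *)
Definition levels n : seq dyadic := flatten [seq level j | j <- iota 0 n].

Lemma mem_level j J : (J \in level j) = (tag J == j).
Proof.
apply/mapP/eqP => [[k _ ->]//|]; case: J => i k /= ij; subst i.
by exists k => //; rewrite mem_enum.
Qed.

Lemma uniq_level j : uniq (level j).
Proof.
rewrite map_inj_uniq ?enum_uniq// => k l /eqP.
by rewrite eq_Tagged /= => /eqP.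
Qed.

Lemma mem_levels n J : (J \in levels n) = (tag J < n)%N.
Proof.
apply/flatten_mapP/idP => [[j]|Jn].
  by rewrite mem_iota mem_level => /= jn /eqP ->.
by exists (tag J); rewrite ?mem_iota ?mem_level.
Qed.

Lemma levelsS n : levels n.+1 = levels n ++ level n.
Proof. by rewrite /levels -addn1 iotaD map_cat flatten_cat /= cats0 add0n. Qed.

Lemma uniq_levels n : uniq (levels n).
Proof.
elim: n => // n IH; rewrite levelsS cat_uniq IH uniq_level andbT /=.
apply/hasPn => J; rewrite mem_level mem_levels => /eqP ->.
by rewrite ltnn.
Qed.

Lemma big_level (V : nmodType) (a : dyadic -> V) j :
  \sum_(J <- level j) a J = \sum_(k < 2 ^ j) a (Tagged (fun j => 'I_(2 ^ j)) k).
Proof. by rewrite /level big_map big_enum. Qed.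

Lemma big_levels (V : nmodType) (a : dyadic -> V) n :
  \sum_(J <- levels n) a J = \sum_(0 <= j < n) \sum_(J <- level j) a J.
Proof.
elim: n => [|n IH]; first by rewrite big_nil big_geq.
by rewrite levelsS big_cat IH big_nat_recr.
Qed.

Lemma fset_sub_levels (F : {fset dyadic}) : exists n, {subset F <= levels n}.
Proof.
exists (\max_(J <- F) (tag J)).+1 => J JF.
by rewrite mem_levels ltnS (big_rem J)//= leq_maxl.
Qed.

End Levels.

Lemma ler_sum_sub (R : numDomainType) (a : dyadic -> R) (r r' : seq dyadic) :
  uniq r -> uniq r' -> {subset r <= r'} -> (forall J, 0 <= a J) ->
  \sum_(J <- r) a J <= \sum_(J <- r') a J.
Proof.
move=> ur ur' rr' a0; rewrite [leRHS](bigID (mem r)) /= -[X in _ <= X + _]big_filter.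
rewrite [X in _ <= X + _](perm_big r) /=; first by rewrite lerDl sumr_ge0.
rewrite uniq_perm ?filter_uniq// => J; rewrite mem_filter andb_idr//; exact: rr'.
Qed.

Section GeometricCauchySchwarz.
Variables (R : realFieldType) (q : R).
Hypothesis q1 : 1 < q.

(** Cauchy-Schwarz with geometric weights, by peeling off the first term with
    (d + T)^2 <= q/(q-1) d^2 + q T^2. *)
Lemma geometric_sum_sqr (d : nat -> R) m e :
  (\sum_(m <= j < m + e) d j) ^+ 2 <=
  q / (q - 1) * q ^- m * \sum_(m <= j < m + e) q ^+ j * d j ^+ 2.
Proof.
have q0 : 0 < q by exact: lt_trans q1.
have q10 : 0 < q - 1 by rewrite subr_gt0.
elim: e m => [|e IH] m; first by rewrite addn0 !big_geq// expr0n mulr0.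
rewrite addnS -addSn !(big_ltn (m := m)) ?addSn ?ltnS ?leq_addr//.
have := IH m.+1; rewrite !addSn; set T := \sum_(m.+1 <= j < _) d j.
set S := \sum_(m.+1 <= j < _) _ => {}IH.
have H : (d m + T) ^+ 2 <= q / (q - 1) * d m ^+ 2 + q * T ^+ 2.
  rewrite -(ler_pM2r q10) -subr_ge0.
  rewrite (_ : _ - _ = (d m - (q - 1) * T) ^+ 2) ?sqr_ge0//.
  by field; rewrite gt_eqF.
apply: (le_trans H); rewrite mulrDr mulrA mulfVK ?expf_neq0 ?gt_eqF// lerD2l.
rewrite -ler_pdivlMl//; apply: (le_trans IH).
by rewrite exprS invfM le_eqVlt; apply/orP; left; apply/eqP; ring.
Qed.

End GeometricCauchySchwarz.

Section HaarSums.
Variable R : realType.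
Implicit Types (f g h : R -> R) (c : dyadic -> R) (r : seq dyadic).
Local Notation mu := (leb R).
Local Notation I0 := (@I0 R).

Definition hsum c r (x : R) : R := \sum_(J <- r) c J * haar J x.

Lemma inL2_hsum c r : inL2 (hsum c r).
Proof. by apply: inL2_lin => J; exact: inL2_haar. Qed.

Lemma inner_hsum c r J : uniq r ->
  inner (hsum c r) (haar J) = if J \in r then c J else 0.
Proof.
move=> ur; rewrite inner_lin; last 2 first.
- by move=> I; exact: inL2_haar.
- exact: inL2_haar.
under eq_bigr do rewrite haar_orthonormal.
case: ifPn => Jr.
  rewrite (bigD1_seq J)//= eqxx mulr1 big1 ?addr0// => I /negPf ->.
  by rewrite mulr0.
rewrite big_seq big1// => I Ir; case: eqP => [E|]; last by rewrite mulr0.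
by rewrite -E Ir in Jr.
Qed.

Lemma l2sq_hsum c r : uniq r -> l2sq (hsum c r) = \sum_(J <- r) c J ^+ 2.
Proof.
move=> ur; rewrite l2sqE [LHS]inner_lin; last 2 first.
- by move=> I; exact: inL2_haar.
- exact: inL2_hsum.
rewrite big_seq [RHS]big_seq; apply: eq_bigr => J Jr.
by rewrite innerC inner_hsum// Jr expr2.
Qed.

Lemma hsumB c c' r x : hsum c r x - hsum c' r x = hsum (fun J => c J - c' J) r x.
Proof. by rewrite /hsum -sumrB; apply: eq_bigr => J _; rewrite mulrBl. Qed.

Lemma hsum_levels c n x : hsum c (levels n) x = \sum_(0 <= j < n) hsum c (level j) x.
Proof. by rewrite /hsum big_levels. Qed.

Lemma hsum_sub c r r' x : uniq r -> uniq r' -> {subset r <= r'} ->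
  hsum c r' x - hsum c r x = hsum c [seq J <- r' | J \notin r] x.
Proof.
move=> ur ur' rr'; rewrite /hsum big_filter [X in X - _](bigID (mem r)) /= -big_filter.
rewrite (perm_big r) /=; first by rewrite addrAC subrr add0r.
rewrite uniq_perm ?filter_uniq// => J; rewrite mem_filter andb_idr//.
exact: rr'.
Qed.

(** The mode of convergence of [is_paraproduct], for arbitrary coefficients. *)
Definition is_sum c g : Prop := inL2 g /\
  forall e : R, 0 < e -> exists F0 : {fset dyadic}, forall F : {fset dyadic},
    (F0 `<=` F)%fset -> (L2norm (hsum c F \- g)%R < e%:E)%E.

Lemma is_sum_near c g (e : R) : is_sum c g -> 0 < e -> exists F0 : {fset dyadic},
  forall F : {fset dyadic}, (F0 `<=` F)%fset -> l2sq (hsum c F \- g) < e ^+ 2.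
Proof.
move=> [g2 cg] e0; have [F0 H] := cg _ e0; exists F0 => F /H.
by rewrite L2norm_lt//; apply: inL2B => //; exact: inL2_hsum.
Qed.

(** A Haar coefficient is continuous in L^2 by Bessel, and that of a partial sum
    over a set containing J is exactly [c J]. *)
Lemma is_sum_coef c g J : is_sum c g -> inner g (haar J) = c J.
Proof.
move=> cg; have g2 := cg.1; apply/eqP; rewrite eq_sym -subr_eq0 -normr_le0.
apply/ler_addgt0Pl => e e0; rewrite addr0.
have [F0 H] := is_sum_near cg e0.
have := H (F0 `|` [fset J])%fset (fsubsetUl _ _).
have JF : J \in (F0 `|` [fset J])%fset by rewrite !inE eqxx orbT.
move: JF; set F := (_ `|` _)%fset => JF /ltW; have h2 := inL2_hsum c F.
move/(le_trans (inner_haar_le J (inL2B h2 g2))); rewrite innerBl//; last exact: inL2_haar.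
rewrite inner_hsum ?fset_uniq// ifT// -[X in X <= _](real_normK (num_real _)).
by rewrite ler_pXn2r// ?nnegrE// ltW.
Qed.

Lemma is_sum_l2sq c g C : is_sum c g -> (forall n, \sum_(J <- levels n) c J ^+ 2 <= C) ->
  l2sq g <= 2 * C.
Proof.
move=> cg cC; have g2 := cg.1; apply/ler_addgt0Pl => e e0.
have e0' : 0 < Num.sqrt (e / 2) by rewrite sqrtr_gt0 divr_gt0.
have [F0 H] := is_sum_near cg e0'.
have := H F0 (fsubset_refl _); rewrite sqr_sqrtr; last by rewrite divr_ge0// ltW.
have h2 := inL2_hsum c F0; move=> He.
have -> : g = hsum c F0 \- (hsum c F0 \- g) by apply/funext => x /=; rewrite subKr.
apply: (le_trans (l2sqB_le h2 (inL2B h2 g2))); rewrite l2sq_hsum ?fset_uniq//.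
have : \sum_(J <- F0) c J ^+ 2 <= C.
  have [n Fn] := fset_sub_levels F0; apply: le_trans (cC n).
  apply: ler_sum_sub; rewrite ?fset_uniq ?uniq_levels// => J; exact: sqr_ge0.
lra.
Qed.

Lemma is_sumB c c' g g' : is_sum c g -> is_sum c' g' ->
  is_sum (fun J => c J - c' J) (g \- g').
Proof.
move=> cg cg'; have [g2 g2'] := (cg.1, cg'.1); split; first exact: inL2B.
move=> e e0; have e2 : 0 < e / 2 by rewrite divr_gt0.
have [F H] := is_sum_near cg e2; have [F' H'] := is_sum_near cg' e2.
exists (F `|` F')%fset => G; rewrite fsubUset => /andP[/H h1 /H' h2].
have i1 := inL2B (inL2_hsum c G) g2; have i2 := inL2B (inL2_hsum c' G) g2'.
rewrite L2norm_lt//; last by apply: inL2B; [exact: inL2_hsum|exact: inL2B].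
have -> : hsum (fun J => c J - c' J) G \- (g \- g') =
  (hsum c G \- g) \- (hsum c' G \- g').
  by apply/funext => x /=; rewrite -hsumB; ring.
apply: le_lt_trans (l2sqB_le i1 i2) _; rewrite exprMn in h1 h2; lra.
Qed.

End HaarSums.

Section Synthesis.
Variables (R : realType) (q : R).
Hypothesis q1 : 1 < q.
Local Notation mu := (leb R).
Local Notation I0 := (@I0 R).

Let q0 : 0 < q. Proof. exact: lt_trans q1. Qed.

(** The terms are dominated by a geometric sequence of ratio q^(-1/2). *)
Lemma weighted_series_cvg (d : nat -> R) B :
  (forall n, \sum_(0 <= j < n) q ^+ j * d j ^+ 2 <= B) -> cvgn (series d).
Proof.
move=> dB.
have B0 : 0 <= B by apply: le_trans (dB 0%N); rewrite big_geq.
have dj j : `|d j| <= Num.sqrt B * Num.sqrt q^-1 ^+ j.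
  rewrite -(@ler_pXn2r _ 2)// ?nnegrE ?mulr_ge0 ?exprn_ge0 ?sqrtr_ge0//.
  rewrite exprMn sqr_sqrtr// -exprM mulnC exprM sqr_sqrtr ?invr_ge0 ?(ltW q0)//.
  rewrite exprVn real_normK ?num_real// ler_pdivlMr ?exprn_gt0// mulrC.
  apply: le_trans (dB j.+1); rewrite big_nat_recr//= lerDr.
  by apply: sumr_ge0 => i _; rewrite mulr_ge0 ?sqr_ge0// exprn_ge0// ltW.
apply: normed_cvg.
apply: (@series_le_cvg _ _ (geometric (Num.sqrt B) (Num.sqrt q^-1))) => //.
- by move=> n /=; exact: normr_ge0.
- by move=> n /=; rewrite mulr_ge0 ?exprn_ge0 ?sqrtr_ge0.
- apply: is_cvg_geometric_series; rewrite ger0_norm ?sqrtr_ge0//.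
  by rewrite -sqrtr1 ltr_sqrt// invf_lt1.
Qed.

Lemma weighted_series_tail (d : nat -> R) B m :
  (forall n, \sum_(0 <= j < n) q ^+ j * d j ^+ 2 <= B) ->
  (limn (series d) - series d m) ^+ 2 <= q / (q - 1) * q ^- m * B.
Proof.
move=> dB; have cd := weighted_series_cvg dB.
have c2 : (fun n => (series d n - series d m) ^+ 2) @ \oo -->
    (limn (series d) - series d m) ^+ 2.
  by under eq_fun do rewrite expr2; rewrite expr2; apply: cvgM;
    apply: cvgB => //; exact: cvg_cst.
rewrite -(cvg_lim _ c2)//; apply: limr_le; first by apply/cvg_ex; eexists; exact: c2.
near=> n; have mn : (m <= n)%N by near: n; exists m.
have -> : series d n - series d m = \sum_(m <= j < m + (n - m)) d j.
  by rewrite subnKC// /series /= (big_cat_nat (leq0n m) mn)//= [X in X - _]addrC addrK.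
apply: le_trans (geometric_sum_sqr q1 _ _ _) _.
rewrite ler_wpM2l ?mulr_ge0 ?invr_ge0 ?exprn_ge0 ?subr_ge0 ?(ltW q0) ?(ltW q1)//.
rewrite subnKC//; apply: le_trans (dB n); rewrite [leRHS](big_cat_nat (leq0n m) mn)//= lerDr.
by apply: sumr_ge0 => i _; rewrite mulr_ge0 ?sqr_ge0// exprn_ge0// ltW.
Unshelve. all: by end_near. Qed.

Variables (c : dyadic -> R) (C : R).
Hypothesis cC : forall n, \sum_(J <- levels n) q ^+ (tag J) * c J ^+ 2 <= C.

Let d j x := hsum c (level j) x.
Let S x : \bar R := (\sum_(0 <= j <oo) (q ^+ j * d j x ^+ 2)%:E)%E.

Let term_ge0 j x : (0 <= (q ^+ j * d j x ^+ 2)%:E)%E.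
Proof. by rewrite lee_fin mulr_ge0 ?sqr_ge0// exprn_ge0// ltW. Qed.

Let S_ge0 x : (0 <= S x)%E.
Proof. by apply: nneseries_ge0 => n _ _; exact: term_ge0. Qed.

Let mterm j : measurable_fun I0 (fun x => (q ^+ j * d j x ^+ 2)%:E).
Proof.
apply/measurable_EFinP; apply: measurable_funM; first exact: measurable_cst.
by apply: measurable_funX; apply: inL2_meas; exact: inL2_hsum.
Qed.

Let mS : measurable_fun I0 S.
Proof. by apply: ge0_emeasurable_sum => // j x _ _; exact: term_ge0. Qed.

Let intS : (\int[mu]_(x in I0) S x <= C%:E)%E.
Proof.
rewrite integral_nneseries//; last exact: measurable_I0.
apply: lime_le; first by apply: is_cvg_nneseries => n _ _; exact: integral_ge0.
near=> n; apply: le_trans (_ : (_ <= (\sum_(J <- levels n) q ^+ (tag J) * c J ^+ 2)%:E)%E) _; last first.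
  by rewrite lee_fin.
rewrite big_levels -sumEFin; apply: lee_sum => j _.
under eq_integral do rewrite EFinM.
have h2 := inL2_hsum c (level j).
rewrite integralZl; [|exact: measurable_I0|exact: inL2_sqr].
rewrite -L2normE L2norm_sqr// l2sq_hsum ?uniq_level// -EFinM lee_fin mulr_sumr.
rewrite big_seq [leRHS]big_seq; apply: ler_sum => J.
by rewrite mem_level => /eqP ->.
Unshelve. all: by end_near. Qed.

(** A smoothness weight q > 1 makes the Haar series converge almost everywhere
    when it is summed generation by generation: the square function
    S = sum_j q^j d_j^2 is integrable, hence finite almost everywhere, and where
    it is finite the tail from generation m on has square at most a multiple of
    q^-m S.  Integrating this pointwise bound gives convergence in L^2; a finite
    set of intervals containing all generations below m adds an error of the
    same order. *)
Lemma synthesis : exists g, is_sum c g.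
Proof.
pose E := I0 `&` [set x | S x \is a fin_num].
have mE : measurable (E : set (measurableTypeR R)).
  by apply: emeasurable_fin_num => //; exact: measurable_I0.
have SE x : E x -> forall n, \sum_(0 <= j < n) q ^+ j * d j x ^+ 2 <= fine (S x).
  move=> [_ /= Sx] n; rewrite -lee_fin fineK// -sumEFin.
  by apply: nneseries_lim_ge => j _ _; exact: term_ge0.
(* Multiplying by the indicator of E makes the convergence hold everywhere, so
   that the limit is measurable. *)
pose h n x := hsum c (levels n) x * (\1_E x : R).
pose g x := limn (series (d ^~ x)) * \1_E x.
have hE n x : hsum c (levels n) x = series (d ^~ x) n by rewrite hsum_levels.
have mg : measurable_fun I0 g.
  apply: (@measurable_fun_cvg _ _ _ _ h) => [n|x _].
    apply: measurable_funM; first by apply: inL2_meas; exact: inL2_hsum.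
    by apply: inL2_meas; exact: inL2_indic.
  rewrite /h /g indicE; case: (boolP (x \in E)) => [/set_mem xE|_].
    under eq_fun do rewrite hE mulr1; rewrite mulr1.
    exact: weighted_series_cvg (SE _ xE).
  by under eq_fun do rewrite mulr0; rewrite mulr0; exact: cvg_cst.
have aeE : {ae mu, forall x, I0 x -> E x}.
  have : mu.-integrable I0 S.
    apply/integrableP; split => //; apply: le_lt_trans (ltry C).
    by under eq_integral do rewrite gee0_abs//.
  move/(integrable_ae measurable_I0); apply: filterS => x Sx xI; split => //=.
  exact: Sx.
have tail m : (\int[mu]_(x in I0) (((g \- hsum c (levels m)) x) ^+ 2)%:E <=
    (q / (q - 1) * q ^- m * C)%:E)%E.
  have K0 : 0 <= q / (q - 1) * q ^- m.
    by rewrite ?mulr_ge0 ?invr_ge0 ?exprn_ge0 ?subr_ge0 ?(ltW q0) ?(ltW q1).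
  apply: (@le_trans _ _ (\int[mu]_(x in I0) ((q / (q - 1) * q ^- m)%:E * S x))%E); last first.
    rewrite ge0_integralZl//; last exact: measurable_I0.
    by rewrite [(_ * C)%:E]EFinM lee_wpmul2l// lee_fin.
  have aeL : {ae mu, forall x, I0 x -> ((((g \- hsum c (levels m)) x) ^+ 2)%:E <=
      (q / (q - 1) * q ^- m)%:E * S x)%E}.
    move: aeE; apply: filterS; first exact: (ae_filter_ringOfSetsType mu).
    move=> x xE xI; have {}xE := xE xI.
    have [_ /= Sx] := xE; rewrite -(fineK Sx) -EFinM lee_fin /g indicE mem_set// mulr1.
    by rewrite hE; apply: weighted_series_tail => n; exact: SE.
  apply: ae_ge0_le_integral.
  - exact: measurable_I0.
  - by move=> x _; rewrite lee_fin sqr_ge0.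
  - apply/measurable_EFinP; apply: measurable_funX; apply: measurable_funB => //.
    by apply: inL2_meas; exact: inL2_hsum.
  - by move=> x _; rewrite mule_ge0// lee_fin.
  - by apply: emeasurable_funM => //; exact: measurable_cst.
  - exact: aeL.
have tail2 m : inL2 (g \- hsum c (levels m)).
  have mh := inL2_meas (inL2_hsum c (levels m)).
  apply: inL2P; first exact: measurable_funB.
  apply/integrableP; split.
    by apply/measurable_EFinP; apply: measurable_funX; exact: measurable_funB.
  apply: le_lt_trans (ltry (q / (q - 1) * q ^- m * C)).
  apply: le_trans (tail m); under eq_integral => x _.
    rewrite gee0_abs; last by rewrite lee_fin sqr_ge0.
    over.
  by [].
have g2 : inL2 g.
  have := inL2D (tail2 0%N) (inL2_hsum c (levels 0)); apply: inL2_eq => x _ /=.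
  by rewrite subrK.
have C0 : 0 <= C by have := cC 0; rewrite big_nil.
(* One term for the tail of the limit, one for the surplus intervals of F. *)
pose K := 2 * (q / (q - 1) * C) + 2 * C.
have K0 : 0 <= K.
  by rewrite addr_ge0 ?mulr_ge0 ?invr_ge0 ?subr_ge0 ?(ltW q0) ?(ltW q1).
have tail3 m F : uniq F -> {subset levels m <= F} -> l2sq (hsum c F \- g) <= q ^- m * K.
  move=> uF mF; have := inL2_hsum c [seq J <- F | J \notin levels m] => f2.
  have -> : hsum c F \- g = hsum c [seq J <- F | J \notin levels m] \- (g \- hsum c (levels m)).
    by apply/funext => x /=; rewrite -hsum_sub ?uniq_levels//; ring.
  apply: le_trans (l2sqB_le f2 (tail2 m)) _.
  have := tail m; rewrite -L2normE L2norm_sqr// lee_fin => tm.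
  suff : l2sq (hsum c [seq J <- F | J \notin levels m]) <= q ^- m * C.
    by move: tm; rewrite /K; set u := q ^- m => h1 h2; lra.
  rewrite l2sq_hsum ?filter_uniq//; set r := [seq J <- F | J \notin levels m].
  rewrite -ler_pdivrMl ?invr_gt0 ?exprn_gt0// invrK.
  have [n rn] : exists n, {subset r <= levels n}.
    exists (\max_(J <- r) (tag J)).+1 => J JF.
    by rewrite mem_levels ltnS (big_rem J)//= leq_maxl.
  apply: le_trans (cC n).
  apply: (@le_trans _ _ (\sum_(i <- r) q ^+ tag i * c i ^+ 2)); last first.
    apply: ler_sum_sub; rewrite ?filter_uniq ?uniq_levels// => J.
    by rewrite mulr_ge0 ?sqr_ge0// exprn_ge0// ltW.
  rewrite mulr_sumr big_seq [leRHS]big_seq; apply: ler_sum => J.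
  rewrite mem_filter mem_levels -leqNgt => /andP[mJ _].
  by rewrite ler_wpM2r ?sqr_ge0// ler_weXn2l// ltW.
exists g; split => // e e0.
have [m Hm] : exists m, q ^- m * K < e ^+ 2.
  have qi : `|q^-1| < 1 by rewrite ger0_norm ?invr_ge0 ?(ltW q0)// invf_lt1.
  have := cvg_geometric K qi => /cvgr_lt -/(_ (e ^+ 2)).
  rewrite exprn_gt0// => /(_ isT) [m _ Hm]; exists m.
  by have := Hm m (leqnn m); rewrite /= exprVn mulrC.
exists [fset J | J in levels m]%fset => F /fsubsetP mF.
have h2 := inL2_hsum c F.
rewrite L2norm_lt//; last exact: inL2B.
apply: le_lt_trans Hm; apply: tail3; first exact: fset_uniq.
by move=> J Jm; apply: mF; rewrite !inE.
Qed.

End Synthesis.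

(** * The Sobolev norm and the capacity *)

Section SobolevNorm.
Variables (R : realType) (s : R).
Hypothesis hs0 : 0 < s.
Implicit Types (f g : R -> R) (I J : dyadic) (n : nat) (E : set R).
Local Notation mu := (leb R).

(** The weight |J|^(-2s) of an interval of generation j is [ratio ^+ j]. *)
Definition ratio : R := 2 `^ (2 * s).

Lemma ratio_gt1 : 1 < ratio.
Proof.
rewrite /ratio -[ltLHS](_ : 1 `^ (2 * s) = 1); last by rewrite powR1.
by apply: gt0_ltr_powR; rewrite ?mulr_gt0 ?nnegrE ?ltr1n.
Qed.

Lemma haar_energyE f J :
  haar_energy s f J = ratio ^+ tag J * (inner f (haar J)) ^+ 2.
Proof.
rewrite /haar_energy real_normK ?num_real//; congr (_ * _).
rewrite /dlen /ratio -(powR_invn (tag J) (ler0n R 2)).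
rewrite -(powR_mulrn (tag J) (powR_ge0 2 (2 * s))) -!(powRrM 2).
by congr (_ `^ _); ring.
Qed.

Lemma haar_energy_ge0 f J : 0 <= haar_energy s f J.
Proof. by rewrite mulr_ge0 ?sqr_ge0// powR_ge0. Qed.

Lemma sum_haar_energy f n : inL2 f ->
  \sum_(J <- levels n) haar_energy s f J =
  \sum_(0 <= j < n) ratio ^+ j * incr (avg_tree f) j.
Proof.
move=> f2; rewrite big_levels; apply: eq_bigr => j _.
rewrite -haar_sum_incr// mulr_sumr big_level; apply: eq_bigr => k _.
by rewrite haar_energyE.
Qed.

Lemma sum_levels_homo (a : dyadic -> R) n m : (forall J, 0 <= a J) -> (n <= m)%N ->
  \sum_(J <- levels n) a J <= \sum_(J <- levels m) a J.
Proof.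
move=> a0 nm; apply: ler_sum_sub; rewrite ?uniq_levels// => J.
by rewrite !mem_levels => /leq_trans; apply.
Qed.

Lemma sum_sub_levels (a : dyadic -> R) r : uniq r -> (forall J, 0 <= a J) ->
  exists n, \sum_(J <- r) a J <= \sum_(J <- levels n) a J.
Proof.
move=> ur a0; exists (\max_(J <- r) (tag J)).+1.
apply: ler_sum_sub; rewrite ?uniq_levels// => J.
by move=> Jr; rewrite mem_levels ltnS (big_rem J)//= leq_maxl.
Qed.

Lemma esum_levels_le (a : dyadic -> R) C : (forall J, 0 <= a J) ->
  (\esum_(J in [set: dyadic]) (a J)%:E <= C%:E)%E <->
  forall n, \sum_(J <- levels n) a J <= C.
Proof.
move=> a0; split=> H.
  move=> n; rewrite -lee_fin; apply: le_trans H; apply: esum_ge.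
  exists [set` levels n]; first by split; [exact: finite_seq|].
  by rewrite -fsbig_seq ?uniq_levels// sumEFin.
apply/ereal_supP => _ [A [fA _] <-].
rewrite (fsbig_finite _ _ fA) /= sumEFin lee_fin.
have [n Hn] := sum_sub_levels (fset_uniq (fset_set A)) a0.
by apply: le_trans Hn _.
Qed.

Lemma Hs_normsqP f C : inL2 f -> (Hs_normsq s f <= C%:E)%E <->
  forall n, \sum_(J <- levels n) haar_energy s f J + l2sq f <= C.
Proof.
move=> f2; rewrite /Hs_normsq L2norm_sqr// -leeBrDr// -EFinB.
rewrite esum_levels_le; last by move=> J; exact: haar_energy_ge0.
by split=> H n; have := H n; rewrite lerBrDr.
Qed.

Lemma Hs_normsq_ge0 f : (0 <= Hs_normsq s f)%E.
Proof.
rewrite adde_ge0// ?expe_ge0 ?L2norm_ge0//.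
by apply: esum_ge0 => J _; rewrite lee_fin haar_energy_ge0.
Qed.

Lemma Hs_normsq_fin f : inHs s f -> exists2 C, 0 <= C & Hs_normsq s f = C%:E.
Proof.
move=> [_]; have := Hs_normsq_ge0 f; case: (Hs_normsq s f) => //= r r0 _.
by exists r.
Qed.

Lemma haar_energyZ c f J : inL2 f ->
  haar_energy s (fun x => c * f x) J = c ^+ 2 * haar_energy s f J.
Proof.
by move=> f2; rewrite !haar_energyE innerZl ?exprMn 1?mulrCA//; exact: inL2_haar.
Qed.

Lemma measurable_dset J : measurable (dset R J : set (measurableTypeR R)).
Proof. exact: measurable_dint. Qed.

Lemma inL2_int_dset f J : inL2 f -> mu.-integrable (dset R J) (EFin \o f).
Proof.
move=> f2; apply: integrableS (inL2_int f2); [exact: measurable_I0|exact: measurable_dset|].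
by apply: dint_sub_I0; exact: ltn_ord.
Qed.

Lemma avgZ (c : R) f J : inL2 f -> avg (fun x => c * f x) J = c * avg f J.
Proof.
move=> f2; have mJ := measurable_dset J.
have iJ := inL2_int_dset J f2.
by rewrite /avg mulrCA -(RintegralZl c mJ iJ).
Qed.

Lemma Hs_normsqZ_le (c C : R) f : inL2 f -> (Hs_normsq s f <= C%:E)%E ->
  (Hs_normsq s (fun x => c * f x)%R <= (c ^+ 2 * C)%:E)%E.
Proof.
move=> f2 /(Hs_normsqP _ f2) H; apply/(Hs_normsqP _ (inL2Z c f2)) => n.
under eq_bigr do rewrite haar_energyZ//.
by rewrite l2sqZ// -mulr_sumr -mulrDr ler_wpM2l ?sqr_ge0.
Qed.

Lemma energy_le_normsq f n C : inL2 f -> (Hs_normsq s f <= C%:E)%E ->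
  energy ratio (avg_tree f) n <= C.
Proof.
move=> f2 /(Hs_normsqP _ f2)/(_ n); apply: le_trans.
by rewrite sum_haar_energy// lerD2l msq_le_l2sq.
Qed.

(** A function of generation n has no Haar coefficients of generation j >= n:
    its mean squares at all such generations are squeezed between that of
    generation n and the L^2 norm, which agree. *)
Lemma Hs_normsq_stepf n w :
  (Hs_normsq s (stepf n w) <= (energy ratio (avg_tree (stepf n w)) n)%:E)%E.
Proof.
have w2 : inL2 (stepf n w) := inL2_stepf n w.
have mw := martingale_avg_tree w2.
have lw : l2sq (stepf n w) = msq (avg_tree (stepf n w)) n.
  by rewrite l2sq_stepf; apply: eq_mean => l ln; rewrite avg_tree_stepf.
apply/(Hs_normsqP _ w2) => m; rewrite sum_haar_energy// lw lerD2r.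
have q0 j : 0 <= ratio ^+ j by rewrite exprn_ge0// ltW// (lt_trans _ ratio_gt1).
have z j : (n <= j)%N -> incr (avg_tree (stepf n w)) j = 0.
  move=> nj; apply/eqP; rewrite eq_le incr_ge0 andbT incrE// subr_le0.
  apply: le_trans (msq_le_l2sq j.+1 w2) _; rewrite lw -(subnK nj); exact: le_msq.
have [mn|/ltnW nm] := leqP m n.
  rewrite [leRHS](big_cat_nat (leq0n m) mn) /= lerDl.
  by apply: sumr_ge0 => j _; rewrite mulr_ge0 ?incr_ge0.
rewrite [leLHS](big_cat_nat (leq0n n) nm) /= gerDl big_nat_cond big1// => j.
by rewrite andbT => /andP[nj _]; rewrite z ?mulr0.
Qed.

Lemma inHs_stepf n w : inHs s (stepf n w).
Proof.
split; first exact: inL2_stepf.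
exact: le_lt_trans (Hs_normsq_stepf n w) (ltry _).
Qed.

Lemma inHsZ (c : R) f : inHs s f -> inHs s (fun x => c * f x).
Proof.
move=> fH; have [f2 _] := fH; have [C _ fC] := Hs_normsq_fin fH.
split; first exact: inL2Z.
by apply: le_lt_trans (Hs_normsqZ_le c f2 (_ : (_ <= C%:E)%E)) (ltry _); rewrite fC.
Qed.

Lemma Cap_le E f C : inHs s f -> {ae mu, forall x, E x -> 1 <= f x} ->
  (Hs_normsq s f <= C%:E)%E -> (Cap s E <= C%:E)%E.
Proof. by move=> fH fE fC; apply: ge_ereal_inf; exists (Hs_normsq s f) => //; exists f. Qed.

Lemma Cap_le1 E : E `<=` dint R 0 0 -> (Cap s E <= 1%:E)%E.
Proof.
move=> E1; apply: (@Cap_le _ (stepf 0 (fun=> 1))); first exact: inHs_stepf.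
  by apply: aeW => x /E1 xE; rewrite (@stepfE _ _ _ 0).
apply: le_trans (Hs_normsq_stepf _ _) _; rewrite lee_fin /energy big_geq// add0r.
rewrite /msq /mean expr0 invr1 mul1r expn0 big_nat1 avg_tree_stepf//.
Qed.

(** f - 1 coincides with |f - 1| almost everywhere on J. *)
Lemma avg_ge1 E f J : inL2 f -> {ae mu, forall x, E x -> 1 <= f x} ->
  dset R J `<=` E -> 1 <= avg f J.
Proof.
move=> f2 fE JE; have mJ := measurable_dset J.
have iJ := inL2_int_dset J f2.
have c1 : inL2 (cst (1 : R) : R -> R).
  by apply: (@inL2_bounded _ _ 1) => // x; rewrite normr1.
have i1 := inL2_int_dset J c1.
rewrite /avg -(ler_pM2l (dlen_gt0 R J)) mulrA divff ?gt_eqF ?dlen_gt0// mul1r mulr1.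
have -> : dlen R J = \int[mu]_(x in dset R J) (cst (1 : R) x).
  rewrite Rintegral_cst; last exact: mJ.
  by rewrite [fine _](congr1 fine (mu_dint R (tag J) (tagged J))) mul1r.
rewrite -subr_ge0 -(RintegralB mJ iJ i1).
have -> : \int[mu]_(x in dset R J) (f x - cst 1 x) = \int[mu]_(x in dset R J) `|f x - 1|.
  congr fine; apply: ae_eq_integral; first exact: mJ.
  - apply/measurable_EFinP; apply: measurable_funB => //.
    by case/integrableP: iJ => /measurable_EFinP.
  - apply/measurable_EFinP; apply: measurableT_comp => //; apply: measurable_funB => //.
    by case/integrableP: iJ => /measurable_EFinP.
  - move: fE; apply: filterS; first exact: (ae_filter_ringOfSetsType mu).
    by move=> x fx /JE /fx f1 /=; rewrite ger0_norm// subr_ge0.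
by apply: Rintegral_ge0.
Qed.

End SobolevNorm.

(** * Carleson families and the testing condition *)

Section Carleson.
Variables (R : realType) (s : R).
Hypothesis hs0 : 0 < s.
Implicit Types (f g b : R -> R) (I J H : dyadic) (n : nat) (E : set R) (P : set dyadic).
Implicit Types (nu : dyadic -> R) (A C t lam : R).
Local Notation mu := (leb R).
Local Notation q := (ratio s).

Let q1 : 1 < q. Proof. exact: ratio_gt1. Qed.

(** The testing condition with constant A, in real numbers only: C ranges over
    the real upper bounds of the capacity, and the sum over all intervals inside
    the family is replaced by its finite partial sums. *)
Definition carleson nu A := forall p (I : 'I_p.+1 -> dyadic), disjoint_family R I ->
  forall C, (Cap s (\bigcup_k dset R (I k)) <= C%:E)%E ->
  forall r, uniq r -> {in r, forall J, exists k, dset R J `<=` dset R (I k)} ->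
  \sum_(J <- r) nu J <= A * C.

Definition weight P b J : R := if J \in P then haar_energy s b J else 0.

Lemma weight_ge0 P b J : 0 <= weight P b J.
Proof. by rewrite /weight; case: ifP => // _; exact: haar_energy_ge0. Qed.

(** All inner sums are brought to the common index set of all dyadic intervals,
    where they can be compared termwise. *)
Lemma family_sumE P b p (I : 'I_p.+1 -> dyadic) :
  (\sum_(k < p.+1) \esum_(J in sub_dyadic R (I k) `&` P) (haar_energy s b J)%:E)%E =
  (\esum_(J in [set: dyadic])
     (\sum_(k < p.+1 | J \in sub_dyadic R (I k)) weight P b J)%:E)%E.
Proof.
under eq_bigr do rewrite esum_mkcond.
rewrite -esum_sum; last first.
  by move=> J k _ _; case: ifP => // _; rewrite lee_fin haar_energy_ge0.
apply: eq_esum => J _; rewrite -sumEFin [RHS]big_mkcond /=; apply: eq_bigr => k _.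
by rewrite /weight in_setI; do 2 case: (_ \in _).
Qed.

Lemma dset_nonempty J : exists x, dset R J x.
Proof. by eexists; exact: dint_nonempty. Qed.

(** A competitor f has average at least 1 on J, so that
    1 <= <f>_J^2 <= |J|^-1 ||f||^2. *)
Lemma Cap_pos E J : dset R J `<=` E -> (Cap s E >= (2 ^- tag J)%:E)%E.
Proof.
move=> JE; apply/ereal_infP => _ [f [fH fE] <-].
have f2 := fH.1; have [C C0 fC] := Hs_normsq_fin fH.
rewrite fC lee_fin; have /(Hs_normsqP _ _ f2) : (Hs_normsq s f <= C%:E)%E by rewrite fC.
move=> /(_ 0%N); rewrite big_nil add0r; apply: le_trans.
rewrite -[X in X <= _]mulr1 ler_pdivrMl ?exprn_gt0//.
apply: le_trans (avg_le J f2); rewrite expr_ge1// ?(le_trans ler01)//; exact: avg_ge1 fE JE.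
Qed.

Lemma dset_sub0 J : dset R J `<=` dint R 0 0.
Proof.
move=> x xJ; have := @dint_anc R (tag J) 0 (tagged J) x; rewrite addn0 => /(_ xJ).
have := @anc_lt (tag J) 0 (tagged J); rewrite addn0 => /(_ (ltn_ord (tagged J))).
by rewrite expn0 ltnS leqn0 => /eqP ->.
Qed.

Lemma Cap_family p (I : 'I_p.+1 -> dyadic) :
  exists2 k : R, 0 < k & Cap s (\bigcup_k dset R (I k)) = k%:E.
Proof.
set E := \bigcup_k _.
have h1 : (Cap s E >= (2 ^- tag (I ord0))%:E)%E by apply: Cap_pos => x xi; exists ord0.
have h2 : (Cap s E <= 1%:E)%E.
  by apply: Cap_le1 => // x [k _]; exact: dset_sub0.
move: h1 h2; case: (Cap s E) => //= k; rewrite lee_fin => h _.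
by exists k => //; apply: lt_le_trans h; rewrite invr_gt0 exprn_gt0.
Qed.

Definition dyadic_top : dyadic :=
  Tagged (fun j => 'I_(2 ^ j)) (Ordinal (ltn0Sn 0) : 'I_(2 ^ 0)).

Lemma carleson_sup_ge0 P b : (0 <= carleson_sup s P b)%E.
Proof.
apply: le_ereal_sup_tmp; eexists.
  exists 0%N, (fun=> dyadic_top); split; last by [].
  by move=> i j _ _ _; rewrite [i]ord1 [j]ord1.
rewrite mule_ge0//.
  by apply: sume_ge0 => k _; apply: esum_ge0 => J _; rewrite lee_fin haar_energy_ge0.
have [k k0 ->] := Cap_family ((fun=> dyadic_top) : 'I_1 -> dyadic).
by rewrite inver gt_eqF// lee_fin invr_ge0 ltW.
Qed.

Lemma carleson_of_sup P b A : 0 <= A ->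
  (carleson_sup s P b <= A%:E)%E -> carleson (weight P b) A.
Proof.
move=> A0 bA p I dI C EC r ur rI.
have [k k0 Ek] := Cap_family I.
have kC : k <= C by rewrite -lee_fin -Ek.
move/ereal_supP: bA => /(_ _ (ex_intro _ p (ex_intro _ I (conj dI erefl)))).
rewrite Ek inver gt_eqF// lee_pdivrMr// family_sumE -EFinM.
have a0 J : 0 <= \sum_(k < p.+1 | J \in sub_dyadic R (I k)) weight P b J.
  by apply: sumr_ge0 => i _; exact: weight_ge0.
move/(esum_levels_le _ a0) => H.
apply: (@le_trans _ _ (\sum_(J <- r)
    \sum_(k < p.+1 | J \in sub_dyadic R (I k)) weight P b J)).
  rewrite big_seq [leRHS]big_seq; apply: ler_sum => J /rI[i Ji].
  rewrite (bigD1 i) /= ?mem_set// lerDl; apply: sumr_ge0 => l _.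
  exact: weight_ge0.
have [n Hn] := sum_sub_levels ur a0; apply: (le_trans Hn); apply: le_trans (H n) _.
by rewrite ler_wpM2l.
Qed.

(** By disjointness an interval J lies inside at most one member of the family,
    and if it does then the average of f over J is at least 1. *)
Lemma family_test P b p (I : 'I_p.+1 -> dyadic) f n : disjoint_family R I ->
  inL2 f -> {ae mu, forall x, (\bigcup_k dset R (I k)) x -> 1 <= f x} ->
  \sum_(J <- levels n) \sum_(k < p.+1 | J \in sub_dyadic R (I k)) weight P b J <=
  \sum_(J <- levels n) weight P b J * avg f J ^+ 2.
Proof.
move=> dI f2 f1; apply: ler_sum => J _.
case: (pselect (exists k, J \in sub_dyadic R (I k))) => [[k Jk]|nJ]; last first.
  rewrite big_pred0; first by rewrite mulr_ge0 ?sqr_ge0 ?weight_ge0.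
  by move=> k; apply/negbTE/negP => Jk; apply: nJ; exists k.
rewrite (bigD1 k) //= big1 ?addr0.
  rewrite ler_peMr ?weight_ge0// expr_ge1//; last first.
    apply: le_trans ler01 _; apply: avg_ge1 f1 _ => //.
    by move: Jk => /set_mem Jk x /Jk xk; exists k.
  apply: avg_ge1 f1 _ => //.
  by move: Jk => /set_mem Jk x /Jk xk; exists k.
move=> l /andP[/set_mem Jl /eqP lk]; exfalso; apply: lk.
have [x xJ] := dset_nonempty J; move/set_mem: Jk => Jk.
by apply: dI => //; exists x; split; [exact: Jl|exact: Jk].
Qed.

(** Testing is necessary: apply the embedding to nearly optimal competitors for
    the capacity, normalized in H^s. *)
Lemma sup_of_embedding P b C :
  (forall f, inHs s f -> (Hs_normsq s f <= 1%:E)%E ->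
    forall n, \sum_(J <- levels n) weight P b J * avg f J ^+ 2 <= C) ->
  (carleson_sup s P b <= C%:E)%E.
Proof.
move=> HC; apply/ereal_supP => _ [p [I [dI ->]]].
have [k k0 Ek] := Cap_family I.
have C0 : 0 <= C.
  have := HC (fun x => 0 * stepf 0 (fun=> 0) x) (inHsZ 0 (inHs_stepf hs0 0 (fun=> 0))).
  move=> /(_ _ 0%N); rewrite big_nil; apply.
  have [z z0 Ez] := Hs_normsq_fin (inHs_stepf hs0 0 (fun=> 0)).
  apply: le_trans (Hs_normsqZ_le 0 (inL2_stepf _ _) (_ : (_ <= z%:E)%E)) _.
    by rewrite Ez.
  by rewrite expr0n mul0r lee_fin.
rewrite Ek inver gt_eqF// lee_pdivrMr// family_sumE -EFinM.
have a0 J : 0 <= \sum_(k < p.+1 | J \in sub_dyadic R (I k)) weight P b J.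
  by apply: sumr_ge0 => i _; exact: weight_ge0.
apply/(esum_levels_le _ a0) => n; apply/ler_addgt0Pl => e e0.
have e1 : 0 < e / (C + 1) by rewrite divr_gt0// ltr_wpDl.
have : (ereal_inf [set Hs_normsq s f | f in [set f | inHs s f /\
   {ae mu, forall x, (\bigcup_k dset R (I k)) x -> (1 <= f x)%R}]] < (k + e / (C + 1))%:E)%E.
  by rewrite -/(Cap s (\bigcup_k dset R (I k))) Ek lte_fin ltrDl.
move=> /ereal_inf_lt [_ [f [fH f1] <-] fk].
have f2 := fH.1; apply: le_trans (family_test P b n dI f2 f1) _.
have [z z0 Ez] := Hs_normsq_fin fH; rewrite Ez lte_fin in fk.
have zpos : 0 < z.
  apply: lt_le_trans k0 _; rewrite -lee_fin -Ez -Ek.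
  by apply: ge_ereal_inf; exists (Hs_normsq s f) => //; exists f.
have := HC _ (inHsZ (Num.sqrt z)^-1 fH).
have zz : (Num.sqrt z)^-1 ^+ 2 = z^-1 by rewrite exprVn sqr_sqrtr.
have N1 : (Hs_normsq s (fun x => (Num.sqrt z)^-1 * f x)%R <= 1%:E)%E.
  apply: le_trans (Hs_normsqZ_le (Num.sqrt z)^-1 f2 (_ : (_ <= z%:E)%E)) _.
    by rewrite Ez.
  by rewrite zz mulVf ?gt_eqF.
move=> /(_ N1 n).
under eq_bigr do rewrite avgZ// exprMn zz mulrCA.
rewrite -mulr_sumr ler_pdivrMl//; move=> H; apply: (le_trans H).
apply: (@le_trans _ _ ((k + e / (C + 1)) * C)); first by rewrite ler_wpM2r// ltW.
rewrite mulrDl [e + _]addrC [C * k]mulrC lerD2l mulrAC -mulrA ler_piMr ?(ltW e0)//.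
by rewrite ler_pdivrMr ?ltr_wpDl// mul1r lerDl.
Qed.

End Carleson.

(** * The embedding theorem *)

Section Embedding.
Variables (R : realType) (s : R).
Hypothesis hs0 : 0 < s.
Implicit Types (f g b : R -> R) (I J H : dyadic) (n : nat).
Implicit Types (nu : dyadic -> R) (A C t lam x : R).
Local Notation mu := (leb R).
Local Notation q := (ratio s).

(** A discrete layer cake formula started at height lam, which needs only
    finitely many heights: above lam the last height below |x| already captures
    a quarter of x^2. *)
Lemma dyadic_layers lam x K : 0 < lam -> `|x| <= lam * 2 ^+ K ->
  x ^+ 2 <= lam ^+ 2 +
    4 * \sum_(0 <= i < K | lam * 2 ^+ i < `|x|) (lam * 2 ^+ i) ^+ 2.
Proof.
move=> l0; rewrite -(real_normK (num_real x)); set y := `|x|.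
have y0 : 0 <= y by exact: normr_ge0.
elim: K => [|K IH] yK.
  rewrite big_geq// mulr0 addr0 ler_pXn2r ?nnegrE ?(ltW l0)//.
  by rewrite expr0 mulr1 in yK.
rewrite big_mkcond big_nat_recr//= -big_mkcond /=.
case: ltP => [h|/IH h]; last by rewrite addr0.
rewrite mulrDr addrA [leRHS]addrC.
have : y ^+ 2 <= (lam * 2 ^+ K.+1) ^+ 2.
  by rewrite ler_pXn2r ?nnegrE// (le_trans y0).
have -> : (lam * 2 ^+ K.+1) ^+ 2 = 4 * (lam * 2 ^+ K) ^+ 2.
  by rewrite [2 ^+ K.+1]exprS; ring.
move=> /le_trans; apply.
rewrite lerDl addr_ge0 ?sqr_ge0// mulr_ge0// sumr_ge0// => i _.
exact: sqr_ge0.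
Qed.

Lemma runmax_nested (v : nat -> nat -> R) j j' k l x : (j <= j')%N ->
  dint R j k x -> dint R j' l x -> runmax v j k <= runmax v j' l.
Proof.
move=> jj xk; rewrite -(subnK jj) => xl; rewrite -(dint_anc_eq xk xl).
exact: runmax_mono.
Qed.

Section StoppingIntervals.
Variables (v : nat -> nat -> R) (t : R) (N : nat).

(** The maximal intervals of a level set of [v]: the value exceeds t at J and at
    no strict ancestor of J.  The parent has index [(tagged J)./2]. *)
Definition stopping J : bool := (t < `|v (tag J) (tagged J)|) &&
  ((tag J == 0%N) || (runmax v (tag J).-1 (tagged J)./2 <= t)).

Definition stops := [seq J <- levels N | stopping J].

Lemma uniq_stops : uniq stops.
Proof. by rewrite filter_uniq// uniq_levels. Qed.

Lemma stops_cover j k : (k < 2 ^ j)%N -> (j < N)%N -> t < runmax v j k ->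
  exists2 H, H \in stops & dint R j k `<=` dset R H.
Proof.
elim: j k => [|j IH] k kj jN tv.
  pose H : dyadic := Tagged (fun j => 'I_(2 ^ j)) (Ordinal kj).
  by exists H => //; rewrite mem_filter mem_levels /stopping /= tv jN.
have [le|gt] := leP (runmax v j k./2) t; last first.
  have k2 : (k./2 < 2 ^ j)%N by rewrite ltn_half_double -mul2n -expnS.
  have [H HS jH] := IH _ k2 (ltnW jN) gt; exists H => //.
  by apply: subset_trans jH; exact: dint_half.
pose H : dyadic := Tagged (fun j => 'I_(2 ^ j)) (Ordinal kj).
exists H => //; rewrite mem_filter mem_levels /stopping /= jN le andbT.
by move: tv; rewrite /= lt_max ltNge le /= => ->.
Qed.

(** Two stopping intervals that meet are nested; if one were strictly larger,
    it would be a strict ancestor of the other at which the value exceeds t. *)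
Lemma stops_disjoint H H' x : H \in stops -> H' \in stops ->
  dset R H x -> dset R H' x -> H = H'.
Proof.
wlog HH : H H' / (tag H <= tag H')%N.
  move=> W h h' xH xH'; case: (leqP (tag H) (tag H')) => [/W|/ltnW/W]; first exact.
  by move=> /(_ h' h xH' xH).
rewrite !mem_filter => /andP[/andP[tH _] _] /andP[/andP[_ sH'] _] xH xH'.
have [E|ne] := eqVneq (tag H) (tag H').
  case: H H' E xH xH' {HH tH sH'} => [j k] [j' k'] /= E; subst j'.
  by move=> h h'; congr Tagged; apply: val_inj; exact: dint_inj h h'.
have {ne}HH : (tag H < tag H')%N by rewrite ltn_neqAle ne.
case: H' xH' sH' HH => [[//|j'] k'] /= xH' sH' HH; exfalso.
have xp : dint R j' k'./2 x by apply: dint_half; exact: xH'.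
rewrite ltnS in HH; have M := runmax_nested v HH xH xp.
by have := le_trans (runmax_ge _ _ _) (le_trans M sH'); rewrite leNgt tH.
Qed.

Lemma stops_family : stops != [::] -> exists p (I : 'I_p.+1 -> dyadic),
  disjoint_family R I /\ forall H, H \in stops <-> exists k, H = I k.
Proof.
case E : stops => [//|H0 r] _; exists (size r), (fun k => nth H0 stops k).
have sz : size stops = (size r).+1 by rewrite E.
split.
  move=> i j _ _ [x [xi xj]]; apply: val_inj; apply/eqP.
  rewrite -(nth_uniq H0 _ _ uniq_stops) ?sz ?ltn_ord//; apply/eqP.
  by apply: stops_disjoint xi xj; rewrite mem_nth ?sz ?ltn_ord.
move=> H; rewrite -E; split=> [HS|[k ->]]; last by rewrite mem_nth ?sz ?ltn_ord.
have kS : (index H stops < (size r).+1)%N by rewrite -sz index_mem.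
by exists (Ordinal kS); rewrite nth_index.
Qed.

End StoppingIntervals.

Lemma carleson_ge0 nu A : (forall J, 0 <= nu J) -> carleson s nu A -> 0 <= A.
Proof.
move=> nu0 cA; have dI : disjoint_family R ((fun=> dyadic_top) : 'I_1 -> dyadic).
  by move=> i j _ _ _; rewrite [i]ord1 [j]ord1.
have := cA _ _ dI 1 _ [::] isT; rewrite big_nil mulr1; apply => //.
by apply: Cap_le1 => // x [k _]; exact: dset_sub0.
Qed.

Lemma carleson_total nu A n : (forall J, 0 <= nu J) -> carleson s nu A ->
  \sum_(J <- levels n) nu J <= A.
Proof.
move=> nu0 cA; have dI : disjoint_family R ((fun=> dyadic_top) : 'I_1 -> dyadic).
  by move=> i j _ _ _; rewrite [i]ord1 [j]ord1.
have := cA _ _ dI 1 _ (levels n) (uniq_levels n); rewrite mulr1; apply => //.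
  by apply: Cap_le1 => // x [k _]; exact: dset_sub0.
move=> J _; exists ord0 => x /dset_sub0.
by rewrite dintE.
Qed.

(** The weight of a level set is at most A times the capacity of the union of
    the stopping intervals.  The slice of the maximal function between t and 2t,
    divided by t, is a competitor for this capacity: below a stopping interval
    for the height 2t the maximal function exceeds 2t. *)
Lemma carleson_level nu A f n t : (forall J, 0 <= nu J) -> carleson s nu A ->
  0 < t -> inL2 f ->
  t ^+ 2 * \sum_(J <- levels n | 2 * t < `|avg f J|) nu J <= A *
    energy q (avg_tree (stepf n (fun l => trunc t (runmax (avg_tree f) n l)))) n.
Proof.
move=> nu0 cA t0 f2; set w := (fun l => trunc t _); set e := energy _ _ _.
have A0 := carleson_ge0 nu0 cA.
have q0 : 0 < q by rewrite (lt_trans _ (ratio_gt1 hs0)).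
have e0 : 0 <= e.
  rewrite /e /energy addr_ge0//; last by apply: mean_ge0 => k; exact: sqr_ge0.
  by apply: sumr_ge0 => j _; rewrite mulr_ge0 ?incr_ge0// exprn_ge0// ltW.
have [S0|SN] := eqVneq (stops (avg_tree f) (2 * t) n) [::].
  rewrite big_seq_cond big_pred0 ?mulr0 ?mulr_ge0// => J.
  apply/negP => /andP[]; rewrite mem_levels avgE => Jn tJ.
  have := stops_cover (ltn_ord (tagged J)) Jn (lt_le_trans tJ (runmax_ge _ _ _)).
  by case=> H; rewrite S0.
have [p [I [dI HI]]] := stops_family SN.
rewrite -ler_pdivlMl ?exprn_gt0// mulrCA.
have -> : \sum_(J <- levels n | 2 * t < `|avg f J|) nu J =
  \sum_(J <- [seq J <- levels n | 2 * t < `|avg f J|]) nu J by rewrite big_filter.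
apply: (cA _ _ dI); [|by rewrite filter_uniq// uniq_levels|]; last first.
  move=> J; rewrite mem_filter mem_levels avgE => /andP[tJ Jn].
  have [H] := stops_cover (ltn_ord (tagged J)) Jn (lt_le_trans tJ (runmax_ge _ _ _)).
  by move=> /HI[k ->] JH; exists k.
have iw := inHs_stepf hs0 n w; have w2 := iw.1.
rewrite -exprVn.
apply: (@Cap_le _ _ _ (fun x => t^-1 * stepf n w x)); [exact: inHsZ| |]; last first.
  apply: Hs_normsqZ_le => //; exact: Hs_normsq_stepf.
apply: aeW => x [k _ xk]; have /HI : exists i, I k = I i by exists k.
rewrite mem_filter mem_levels => /andP[/andP[tH _] Hn].
have x01 : exists2 l, (l < 2 ^ n)%N & dint R n l x.
  have := dset_sub0 xk => /dintP; rewrite expr0 mulr1 => /andP[h1 h2].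
  exact: dint_exists.
have [l ln xl] := x01; rewrite (stepfE _ ln xl).
suff E : trunc t (runmax (avg_tree f) n l) = t by rewrite /w E mulVf// gt_eqF.
apply: trunc_max; first exact: ltW.
have := runmax_nested (avg_tree f) (ltnW Hn) xk xl.
by apply: le_trans; apply: le_trans (runmax_ge _ _ _); exact: ltW.
Qed.

(** 64 = 4 * 4 * 4: a factor 4 from [dyadic_layers], one from the heights
    lam 2^i / 2 at which the maximal function is sliced, and one from Doob's
    inequality. *)
Definition embedding_const : R := 1 + 64 * (q / (q - 1)).

Lemma embedding_const_gt0 : 0 < embedding_const.
Proof.
have q1 := ratio_gt1 hs0; rewrite ltr_wpDr// mulr_ge0// divr_ge0// ?subr_ge0 ltW//.
exact: lt_trans q1.
Qed.

(** The averages below lam are paid for by the total weight, which is at most A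
    because the capacity of the unit interval is at most 1; those above lam by
    the layers lam 2^i, each of them handled by [carleson_level] with
    t = lam 2^i / 2. *)
Lemma carleson_embedding nu A f n lam : (forall J, 0 <= nu J) -> carleson s nu A ->
  0 < lam -> inHs s f -> (Hs_normsq s f <= (lam ^+ 2)%:E)%E ->
  \sum_(J <- levels n) nu J * avg f J ^+ 2 <= embedding_const * A * lam ^+ 2.
Proof.
move=> nu0 cA l0 fH fl; have f2 := fH.1; have A0 := carleson_ge0 nu0 cA.
have q1 := ratio_gt1 hs0.
have [K HK] : exists K, forall J, J \in levels n -> `|avg f J| <= lam * 2 ^+ K.
  pose M := \sum_(J <- levels n) `|avg f J| / lam.
  have M0 : 0 <= M by apply: sumr_ge0 => J _; rewrite divr_ge0// ltW.
  exists (Num.truncn M).+1 => J Jn; rewrite mulrC -ler_pdivrMr//.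
  have : `|avg f J| / lam <= M.
    rewrite /M (big_rem J)//= lerDl; apply: sumr_ge0 => I _.
    by rewrite divr_ge0// ltW.
  move=> /le_trans; apply; apply: ltW; apply: lt_le_trans (truncnS_gt M) _.
  by rewrite -natrX ler_nat ltnW// ltn_expl.
apply: (@le_trans _ _ (\sum_(J <- levels n) nu J * (lam ^+ 2 +
    4 * \sum_(0 <= i < K | lam * 2 ^+ i < `|avg f J|) (lam * 2 ^+ i) ^+ 2))).
  rewrite big_seq [leRHS]big_seq; apply: ler_sum => J Jn.
  by rewrite ler_wpM2l// dyadic_layers// HK.
under eq_bigr do rewrite mulrDr.
rewrite big_split /= -mulr_suml /embedding_const !mulrDl mul1r; apply: lerD.
  by rewrite ler_wpM2r ?sqr_ge0// carleson_total.
under eq_bigr => J _.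
  rewrite big_mkcond /= mulrCA mulr_sumr.
  over.
rewrite -mulr_sumr exchange_big /=.
pose u i := avg_tree (stepf n (fun l => trunc (lam / 2 * 2 ^+ i) (runmax (avg_tree f) n l))).
have ti i : 0 < lam / 2 * 2 ^+ i by rewrite mulr_gt0 ?divr_gt0// exprn_gt0.
apply: (@le_trans _ _ (4 * \sum_(0 <= i < K) 4 * (A * energy q (u i) n))).
  rewrite ler_wpM2l//; apply: ler_sum => i _.
  apply: le_trans (_ : _ <= 4 * ((lam / 2 * 2 ^+ i) ^+ 2 *
     \sum_(J <- levels n | 2 * (lam / 2 * 2 ^+ i) < `|avg f J|) nu J)) _; last first.
    by rewrite ler_wpM2l// carleson_level.
  rewrite le_eqVlt; apply/orP; left; apply/eqP.
  have -> : 2 * (lam / 2 * 2 ^+ i) = lam * 2 ^+ i by field.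
  rewrite [in RHS]big_mkcond mulrA mulr_sumr; apply: eq_bigr => J _ /=.
  by case: ifP => _; [field|rewrite !mulr0].
rewrite -mulr_sumr -mulr_sumr.
have E1 : \sum_(0 <= i < K) energy q (u i) n <= 4 * (q / (q - 1)) * energy q (avg_tree f) n.
  apply: (@energy_trunc_runmax _ _ q1 _ _ _ _ (lam / 2)).
  - by rewrite divr_ge0// ltW.
  - exact: martingale_avg_tree.
  - by move=> i; apply: martingale_avg_tree; exact: inL2_stepf.
  - by move=> i k kn; rewrite /u avg_tree_stepf.
have E2 : energy q (avg_tree f) n <= lam ^+ 2 by exact: energy_le_normsq.
have K0 : 0 <= q / (q - 1) by rewrite divr_ge0 ?subr_ge0 ?(ltW q1)// (le_trans ler01 (ltW q1)).
have E3 : \sum_(0 <= i < K) energy q (u i) n <= 4 * (q / (q - 1)) * lam ^+ 2.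
  by apply: le_trans E1 _; rewrite ler_wpM2l// mulr_ge0.
have := ler_wpM2l A0 E3; set k := q / (q - 1); set S := \sum_(0 <= i < K) _.
rewrite -[S]/S => E4.
rewrite [leRHS](_ : _ = 4 * (4 * (A * (4 * k * lam ^+ 2)))); last by ring.
by rewrite ler_wpM2l// ler_wpM2l.
Qed.

End Embedding.

(** * Bounded paraproducts *)

Section Paraproduct.
Variables (R : realType) (s : R).
Hypothesis hs0 : 0 < s.
Implicit Types (f g h b : R -> R) (J : dyadic) (n : nat) (P : set dyadic).
Implicit Types (c : dyadic -> R) (A C z : R).
Local Notation q := (ratio s).
Local Notation K := (embedding_const s).

Lemma Hs_norm_le f C : 0 <= C ->
  (Hs_norm s f <= C%:E)%E = (Hs_normsq s f <= (C ^+ 2)%:E)%E.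
Proof.
move=> C0; rewrite /Hs_norm -[X in (_ <= X)%E](_ : sqrte (C%:E ^+ 2)%E = C%:E).
  by rewrite lee_sqrt ?expe_ge0// EFin_expe.
by rewrite sqrte_sqr gee0_abs.
Qed.

Lemma Hs_norm_ge0 f : (0 <= Hs_norm s f)%E.
Proof. exact: sqrte_ge0. Qed.

Lemma carleson_embedding_le nu A f n z : (forall J, 0 <= nu J) ->
  carleson s nu A -> inHs s f -> (Hs_normsq s f <= z%:E)%E ->
  \sum_(J <- levels n) nu J * avg f J ^+ 2 <= K * A * z.
Proof.
move=> nu0 cA fH fz; have A0 := carleson_ge0 hs0 nu0 cA.
have K0 := embedding_const_gt0 hs0.
have z0 : 0 <= z by rewrite -lee_fin; apply: le_trans fz; exact: Hs_normsq_ge0.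
have KA : 0 < K * A + 1 by rewrite ltr_wpDl// mulr_ge0// ltW.
apply/ler_addgt0Pr => e e0; pose d := e / (K * A + 1).
have d0 : 0 < d by rewrite divr_gt0.
have zd : 0 < z + d by rewrite ltr_wpDl.
have H := @carleson_embedding _ _ hs0 nu A f n (Num.sqrt (z + d)) nu0 cA _ fH.
rewrite sqrtr_gt0 sqr_sqrtr ?(ltW zd)// in H.
apply: le_trans (H zd _) _; first by rewrite (le_trans fz)// lee_fin lerDl ltW.
rewrite mulrDr lerD2l /d mulrCA -[leRHS]mulr1 ler_wpM2l ?(ltW e0)//.
by rewrite ler_pdivrMr// mul1r lerDl.
Qed.

Definition paraproduct_coef b f J : R := inner b (haar J) * avg f J.

Lemma haar_energy_sum c g J : is_sum c g -> haar_energy s g J = q ^+ tag J * c J ^+ 2.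
Proof. by move=> cg; rewrite haar_energyE (is_sum_coef J cg). Qed.

Lemma paraproduct_coef_energy b f J :
  q ^+ tag J * paraproduct_coef b f J ^+ 2 = haar_energy s b J * avg f J ^+ 2.
Proof. by rewrite haar_energyE /paraproduct_coef exprMn mulrA. Qed.

(** Since the weights are at least 1, the L^2 part of the norm is at most twice
    the weighted coefficient sum. *)
Lemma is_sum_Hs c g C : is_sum c g ->
  (forall n, \sum_(J <- levels n) q ^+ tag J * c J ^+ 2 <= C) ->
  inHs s g /\ (Hs_normsq s g <= (3 * C)%:E)%E.
Proof.
move=> cg cC; have g2 := cg.1.
have H : (Hs_normsq s g <= (3 * C)%:E)%E.
  apply/(Hs_normsqP _ _ g2) => n.
  under eq_bigr do rewrite (haar_energy_sum _ cg).
  have : l2sq g <= 2 * C.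
    apply: (is_sum_l2sq cg) => m; apply: le_trans (cC m); apply: ler_sum => J _.
    by rewrite ler_peMl ?sqr_ge0// exprn_ege1// ltW// ratio_gt1.
  have := cC n; lra.
by split => //; split => //; apply: le_lt_trans H (ltry _).
Qed.

Lemma weightT b J : weight s setT b J = haar_energy s b J.
Proof. by rewrite /weight in_setT. Qed.

Lemma paraproduct_coef_bound b A f z n : 0 <= A -> (carleson_sup s setT b <= A%:E)%E ->
  inHs s f -> (Hs_normsq s f <= z%:E)%E ->
  \sum_(J <- levels n) q ^+ tag J * paraproduct_coef b f J ^+ 2 <= K * A * z.
Proof.
move=> A0 bA fH fz; have cA := carleson_of_sup hs0 A0 bA.
have := carleson_embedding_le n (weight_ge0 s setT b) cA fH fz.
by under eq_bigr do rewrite weightT -paraproduct_coef_energy.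
Qed.

Lemma paraproduct_exists b A f : 0 <= A -> (carleson_sup s setT b <= A%:E)%E ->
  inHs s f -> exists g, is_paraproduct b f g.
Proof.
move=> A0 bA fH; have [z z0 Ez] := Hs_normsq_fin fH.
apply: (@synthesis _ q (ratio_gt1 hs0) _ (K * A * z)) => n.
by apply: paraproduct_coef_bound => //; rewrite Ez.
Qed.

Lemma paraproduct_upper b A f g z : 0 <= A -> (carleson_sup s setT b <= A%:E)%E ->
  inHs s f -> (Hs_normsq s f <= z%:E)%E -> is_paraproduct b f g ->
  inHs s g /\ (Hs_normsq s g <= (3 * (K * A * z))%:E)%E.
Proof.
by move=> A0 bA fH fz fg; apply: is_sum_Hs fg _ => n; exact: paraproduct_coef_bound.
Qed.

Lemma paraproduct_lower b C :
  (forall f, inHs s f -> (Hs_normsq s f <= 1%:E)%E ->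
     exists2 g, is_paraproduct b f g & (Hs_normsq s g <= C%:E)%E) ->
  (carleson_sup s setT b <= C%:E)%E.
Proof.
move=> H; apply: (sup_of_embedding hs0) => f fH f1 n.
have [g fg gC] := H f fH f1; have g2 := fg.1.
have /(Hs_normsqP _ _ g2) := gC => /(_ n); apply: le_trans.
rewrite -[leLHS]addr0 lerD ?l2sq_ge0//; apply: ler_sum => J _.
by rewrite weightT -paraproduct_coef_energy (haar_energy_sum J fg).
Qed.

Lemma inBMOsP b : inL1 b ->
  inBMOs s b <-> exists2 A, 0 <= A & carleson_sup s setT b = A%:E.
Proof.
move=> b1; have S0 := carleson_sup_ge0 hs0 setT b; rewrite /inBMOs /BMOs_norm.
split=> [[_]|[A A0 ->]]; last by split => //; exact: ltry.
move: S0; case: (carleson_sup s setT b) => [r r0 _|_ /=|//].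
  by exists r => //; rewrite -lee_fin.
by rewrite ltxx.
Qed.

Lemma paraproduct_bounded_iff b : inL1 b -> paraproduct_bounded s b <-> inBMOs s b.
Proof.
move=> b1; rewrite inBMOsP//; split=> [[C HC]|[A A0 EA]].
  have H : (carleson_sup s setT b <= (C ^+ 2)%:E)%E.
    apply: paraproduct_lower => f fH f1; have [g [fg gH gf]] := HC f fH.
    exists g => //; rewrite -real_normK ?num_real// -Hs_norm_le//.
    apply: (le_trans gf); have : (Hs_norm s f <= 1%:E)%E by rewrite Hs_norm_le// expr1n.
    have := Hs_norm_ge0 f; case: (Hs_norm s f) => //= r; rewrite !lee_fin => r0 r1.
    apply: (@le_trans _ _ (`|C| * r)); first by rewrite ler_wpM2r// ler_norm.
    by rewrite ler_piMr.
  move: H (carleson_sup_ge0 hs0 setT b); case: (carleson_sup s setT b) => //= r _ r0.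
  by exists r => //; rewrite -lee_fin.
exists (Num.sqrt (3 * (K * A))) => f fH.
have bA : (carleson_sup s setT b <= A%:E)%E by rewrite EA.
have [g fg] := paraproduct_exists A0 bA fH; exists g.
have [z z0 Ez] := Hs_normsq_fin fH.
have fz : (Hs_normsq s f <= z%:E)%E by rewrite Ez.
have [gH gz] := paraproduct_upper A0 bA fH fz fg; split => //.
have -> : Hs_norm s f = (Num.sqrt z)%:E by rewrite /Hs_norm Ez.
rewrite -EFinM Hs_norm_le ?mulr_ge0 ?sqrtr_ge0// exprMn !sqr_sqrtr//.
  by move: gz; rewrite !mulrA.
by rewrite !mulr_ge0// ltW// embedding_const_gt0.
Qed.

Lemma paraproduct_opnorm_equiv b : inBMOs s b ->
  (1%:E * BMOs_norm s b <= paraproduct_opnorm s b)%E /\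
  (paraproduct_opnorm s b <= (Num.sqrt (3 * K))%:E * BMOs_norm s b)%E.
Proof.
move=> bB; have /(inBMOsP bB.1) [A A0 EA] := bB.
have bA : (carleson_sup s setT b <= A%:E)%E by rewrite EA.
have K0 := embedding_const_gt0 hs0.
have -> : BMOs_norm s b = (Num.sqrt A)%:E by rewrite /BMOs_norm EA.
have ub f g : inHs s f -> (Hs_norm s f <= 1)%E -> is_paraproduct b f g ->
    (Hs_norm s g <= paraproduct_opnorm s b)%E.
  by move=> fH f1 fg; apply: ereal_sup_ubound; exists g => //; exists f.
split; last first.
  apply/ereal_supP => _ [g [f [fH f1 fg]] <-].
  rewrite -EFinM Hs_norm_le ?mulr_ge0 ?sqrtr_ge0// exprMn !sqr_sqrtr//; last first.
    by rewrite mulr_ge0// ltW.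
  have fz : (Hs_normsq s f <= 1%:E)%E.
    by have := f1; rewrite -[1%E]/(1%:E) Hs_norm_le// expr1n.
  by have [_] := paraproduct_upper A0 bA fH fz fg; rewrite mulr1 mulrA.
rewrite mul1e; have [->|ny] := eqVneq (paraproduct_opnorm s b) +oo%E; first exact: leey.
have f0 := inHsZ 0 (inHs_stepf hs0 0 (fun=> 0)).
have f01 : (Hs_norm s (fun x => 0 * stepf 0 (fun=> 0) x)%R <= 1)%E.
  rewrite -[1%E]/(1%:E) Hs_norm_le// expr1n.
  have [z z0 Ez] := Hs_normsq_fin (inHs_stepf hs0 0 (fun=> 0)).
  apply: le_trans (Hs_normsqZ_le 0 (inL2_stepf _ _) (_ : (_ <= z%:E)%E)) _.
    by rewrite Ez.
  by rewrite expr0n mul0r lee_fin.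
have [g0 fg0] := paraproduct_exists A0 bA f0.
have op0 := le_trans (Hs_norm_ge0 g0) (ub _ _ f0 f01 fg0).
move: ny op0 ub; case: (paraproduct_opnorm s b) => //= r _; rewrite lee_fin => r0 ub.
rewrite lee_fin -(@ler_pXn2r _ 2)// ?nnegrE ?sqrtr_ge0// sqr_sqrtr//.
rewrite -lee_fin -EA; apply: paraproduct_lower => f fH f1.
have [g fg] := paraproduct_exists A0 bA fH; exists g => //.
rewrite -Hs_norm_le//; apply: ub fg => //.
by rewrite -[1%E]/(1%:E) Hs_norm_le// expr1n.
Qed.

End Paraproduct.

(** * Compact paraproducts *)

Section Subsequences.
Variable R : realType.

Lemma ereal_cvg0P (u : nat -> \bar R) : (forall n, (0 <= u n)%E) ->
  u @ \oo --> 0%E <->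
  forall e : R, 0 < e -> exists N, forall n, (N <= n)%N -> (u n <= e%:E)%E.
Proof.
move=> u0; split=> [/fine_cvgP[[N1 _ ufin] uc] e e0|H].
  move/cvgrPdist_le: uc => /(_ e e0) [N2 _ ue].
  exists (maxn N1 N2) => n; rewrite geq_max => /andP[n1 n2].
  have := ue n n2; rewrite /= sub0r normrN -lee_fin => h.
  by rewrite -(fineK (ufin n n1)); apply: le_trans h; rewrite lee_fin ler_norm.
have fin n e : (u n <= e%:E)%E -> u n \is a fin_num.
  by move=> h; rewrite ge0_fin_numE// (le_lt_trans h)// ltry.
apply/fine_cvgP; split.
  have [N HN] := H 1 ltr01; exists N => // n Nn; exact: fin (HN n Nn).
apply/cvgrPdist_le => e e0; have [N HN] := H e e0; exists N => // n Nn /=.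
have un := HN n Nn; rewrite sub0r normrN ger0_norm ?fine_ge0//.
by rewrite -lee_fin fineK//; exact: fin un.
Qed.

Lemma tail_small (a : dyadic -> R) (C e : R) : (forall J, 0 <= a J) ->
  (forall n, \sum_(J <- levels n) a J <= C) -> 0 < e ->
  exists N, forall n, \sum_(J <- levels n | (N <= tag J)%N) a J <= e.
Proof.
move=> a0 aC e0; pose S := range (fun n => \sum_(J <- levels n) a J).
have hS : has_sup S.
  by split; [exists (\sum_(J <- levels 0) a J), 0%N|exists C => _ [n _ <-]].
have [_ [N _ <-] HN] := sup_adherent e0 hS; exists N => n.
pose m := maxn n N.
have Sm : \sum_(J <- levels m) a J <= sup S by apply: sup_upper_bound => //; exists m.
apply: (@le_trans _ _ (\sum_(J <- levels m | (N <= tag J)%N) a J)).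
  rewrite big_mkcond [leRHS]big_mkcond; apply: sum_levels_homo; last exact: leq_maxl.
  by move=> J; case: ifP.
have : \sum_(J <- levels m) a J =
    \sum_(J <- levels N) a J + \sum_(J <- levels m | (N <= tag J)%N) a J.
  rewrite (bigID (fun J => N <= tag J)%N) /= addrC; congr (_ + _).
  rewrite -big_filter; apply: perm_big; rewrite uniq_perm ?filter_uniq ?uniq_levels// => J.
  by rewrite mem_filter !mem_levels -ltnNge leq_max; case: ltnP; rewrite ?orbT.
lra.
Qed.

(** A cluster point in the product of the compact intervals [-B J, B J]; basic
    neighbourhoods of the product topology constrain finitely many J. *)
Lemma pointwise_cluster (x : nat -> dyadic -> R) (B : dyadic -> R) :
  (forall n J, `|x n J| <= B J) ->
  exists a : dyadic -> R, forall (e : R) N m0, 0 < e ->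
    exists2 m, (m0 <= m)%N & forall J, J \in levels N -> `|x m J - a J| <= e.
Proof.
move=> xB.
pose A J : set R := `[- B J, B J]%classic.
have cK := @tychonoff _ (fun _ : dyadic => R : topologicalType) A
  (fun J => @segment_compact R (- B J) (B J)).
have [|a [_ ca]] := cK (x @ \oo) _.
  exists 0%N => // n _ J; rewrite /A /= in_itv /= -ler_norml; exact: xB.
exists a => e N m0 e0.
pose U (r : seq dyadic) := [set y : dyadic -> R | forall J, J \in r -> `|y J - a J| <= e].
have FF : Filter (nbhs (a : prod_topology (fun _ : dyadic => R : topologicalType))).
  exact: nbhs_filter.
have nU r : nbhs (a : prod_topology (fun _ : dyadic => R : topologicalType)) (U r).
  elim: r => [|I r IH]; first by apply: filterS filterT => y _ J.
  have nI : nbhs (a : prod_topology (fun _ : dyadic => R : topologicalType))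
      [set y | `|y I - a I| <= e].
    have := @proj_continuous _ (fun _ : dyadic => R : topologicalType) I a.
    move=> /(_ [set z : R | `|z - a I| <= e]); apply.
    by apply/nbhs_ballP; exists e => //= z /=; rewrite /ball /= distrC => /ltW.
  apply: filterS (filterI nI IH) => y [yI yr] J; rewrite inE => /orP[/eqP ->//|].
  exact: yr.
have FA : (x @ \oo) (x @` [set m | (m0 <= m)%N]) by exists m0 => // m m0m; exists m.
have [y [[m mm0 <-] yU]] := ca _ _ FA (nU (levels N)).
by exists m.
Qed.

End Subsequences.

Section Compactness.
Variables (R : realType) (s : R).
Hypothesis hs0 : 0 < s.
Implicit Types (f g h b : R -> R) (J : dyadic) (n N : nat).
Implicit Types (nu c : dyadic -> R) (A C z e : R).
Local Notation q := (ratio s).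
Local Notation K := (embedding_const s).
Local Notation short_set N := [set J : dyadic | dlen R J < 2 ^- N].

Lemma short_setE N J : (J \in short_set N) = (N < tag J)%N.
Proof.
have -> : (J \in short_set N) = (dlen R J < 2 ^- N) by apply/idP/idP; rewrite inE.
rewrite /dlen ltf_pV2 ?posrE ?exprn_gt0//.
by rewrite -!natrX ltr_nat ltn_exp2l.
Qed.

Lemma weight_shortE N b J :
  weight s (short_set N) b J = if (N < tag J)%N then haar_energy s b J else 0.
Proof. by rewrite /weight short_setE. Qed.

(** The embedding restricted to the intervals shorter than 2^-N has a constant
    that tends to 0 with N. *)
Definition uniform_tails b := forall e, 0 < e -> exists N, forall f, inHs s f ->
  (Hs_normsq s f <= 1%:E)%E -> forall n,
  \sum_(J <- levels n) weight s (short_set N) b J * avg f J ^+ 2 <= e.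

Lemma haar_energy_le2 g h J : inL2 g -> inL2 h ->
  haar_energy s g J <= 2 * haar_energy s (g \- h) J + 2 * haar_energy s h J.
Proof.
move=> g2 h2; rewrite !haar_energyE innerBl//; last exact: inL2_haar.
set x := inner g _; set y := inner h _; set p := _ ^+ tag J.
have p0 : 0 <= p by rewrite exprn_ge0// powR_ge0.
rewrite -subr_ge0 (_ : _ - _ = p * (x - 2 * y) ^+ 2); last by ring.
by rewrite mulr_ge0// sqr_ge0.
Qed.

(** Otherwise there are f_N in the unit ball whose images carry energy more than
    e on the intervals shorter than 2^-N.  Along a subsequence the images
    converge to some h, and the energy of h on short intervals is small, a
    contradiction. *)
Lemma compact_uniform_tails b : paraproduct_compact s b -> uniform_tails b.
Proof.
move=> [ex cpt] e e0; apply: contrapT => H.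
have /choice[f Hf] : forall N, exists f, [/\ inHs s f, (Hs_normsq s f <= 1%:E)%E &
    exists n, e < \sum_(J <- levels n) weight s (short_set N) b J * avg f J ^+ 2].
  move=> N; apply: contrapT => HN; apply: H; exists N => f fH f1 n.
  by rewrite leNgt; apply/negP => en; apply: HN; exists f; split => //; exists n.
have /choice[g Hg] : forall N, exists g, is_paraproduct b (f N) g.
  by move=> N; have [fH _ _] := Hf N; have [g fg _] := ex _ fH; exists g.
have [|phi [h [phi_incr hH gh]]] := cpt f g 1 _ Hg.
  move=> n; have [fH f1 _] := Hf n; split => //.
  by rewrite Hs_norm_le// expr1n.
have phin n : (n <= phi n)%N.
  by elim: n => // n IH; apply: leq_ltn_trans IH _; exact: phi_incr.
have h2 := hH.1; have [C C0 EC] := Hs_normsq_fin hH.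
have e8 : 0 < e / 8 by rewrite divr_gt0.
have [N0 HN0] : exists N, forall n,
    \sum_(J <- levels n | (N <= tag J)%N) haar_energy s h J <= e / 8.
  apply: (@tail_small _ _ C) => //; first by move=> J; exact: haar_energy_ge0.
  have /(Hs_normsqP _ _ h2) hC : (Hs_normsq s h <= C%:E)%E by rewrite EC.
  by move=> n; apply: le_trans (hC n); rewrite lerDl l2sq_ge0.
have se8 : 0 < Num.sqrt (e / 8) by rewrite sqrtr_gt0.
have [N1 HN1] := (ereal_cvg0P (fun n => Hs_norm_ge0 s _)).1 gh _ se8.
pose n := maxn N0 N1; have := HN1 n (leq_maxr _ _).
rewrite Hs_norm_le ?sqrtr_ge0// sqr_sqrtr ?(ltW e8)//.
have g2 : inL2 (g (phi n)) := (Hg (phi n)).1.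
have gh2 : inL2 (g (phi n) \- h) by exact: inL2B.
move/(Hs_normsqP _ _ gh2) => gh8.
have [_ _ [m]] := Hf (phi n); rewrite ltNge => /negP; apply.
apply: (@le_trans _ _ (\sum_(J <- levels m) (2 * haar_energy s (g (phi n) \- h) J +
    2 * if (N0 <= tag J)%N then haar_energy s h J else 0))).
  apply: ler_sum => J _; rewrite weight_shortE; case: ifPn => [nJ|_]; last first.
    rewrite mul0r addr_ge0// mulr_ge0// ?haar_energy_ge0//.
    by case: ifP => _ //; exact: haar_energy_ge0.
  rewrite (leq_trans (leq_maxl N0 N1) (leq_trans (phin n) (ltnW nJ))).
  by rewrite -paraproduct_coef_energy -(haar_energy_sum s J (Hg (phi n))) haar_energy_le2.
rewrite big_split /= -!mulr_sumr -big_mkcond /=.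
have := HN0 m; have := gh8 m; have := l2sq_ge0 (g (phi n) \- h).
move=> a1 a2 a3; lra.
Qed.

Lemma uniform_tails_sup b : uniform_tails b -> forall e, 0 < e ->
  exists N0, forall N, (N0 <= N)%N -> (carleson_sup s (short_set N) b <= e%:E)%E.
Proof.
move=> tb e e0; have [N0 HN0] := tb e e0; exists N0 => N NN.
apply: (sup_of_embedding hs0) => f fH f1 n; apply: le_trans (HN0 f fH f1 n).
apply: ler_sum => J _; rewrite ler_wpM2r ?sqr_ge0// !weight_shortE.
case: ifPn => [NJ|_]; first by rewrite (leq_ltn_trans NN NJ).
by case: ifP => // _; exact: haar_energy_ge0.
Qed.

(** Besides the tail there are finitely many intervals, on each of which the
    average is bounded in terms of the L^2 norm. *)
Lemma uniform_tails_inBMOs b : inL1 b -> uniform_tails b -> inBMOs s b.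
Proof.
move=> b1 tb; apply/inBMOsP => //.
have [N HN] := tb 1 ltr01.
have : (carleson_sup s setT b <=
    (1 + \sum_(J <- levels N.+1) haar_energy s b J * 2 ^+ tag J)%:E)%E.
  apply: (sup_of_embedding hs0) => f fH f1 n.
  have f2 := fH.1; have /(Hs_normsqP _ _ f2) f1' := f1.
  have fl : l2sq f <= 1.
    by have := f1' 0%N; rewrite big_nil add0r.
  have E J : weight s setT b J * avg f J ^+ 2 = weight s (short_set N) b J * avg f J ^+ 2 +
      if (tag J <= N)%N then haar_energy s b J * avg f J ^+ 2 else 0.
    by rewrite weightT weight_shortE; case: ltnP => _; rewrite ?mul0r ?add0r ?addr0.
  under eq_bigr do rewrite E.
  rewrite big_split /= lerD ?HN// -big_mkcond /= -big_filter.
  apply: (@le_trans _ _ (\sum_(J <- [seq J <- levels n | (tag J <= N)%N])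
      haar_energy s b J * 2 ^+ tag J)).
    apply: ler_sum => J _; rewrite ler_wpM2l ?haar_energy_ge0//.
    by apply: le_trans (avg_le J f2) _; rewrite ler_piMr// exprn_ge0.
  apply: ler_sum_sub; rewrite ?filter_uniq ?uniq_levels// => J.
    by rewrite mem_filter !mem_levels ltnS => /andP[].
  by rewrite mulr_ge0 ?haar_energy_ge0// exprn_ge0.
move: (carleson_sup_ge0 hs0 setT b); case: (carleson_sup s setT b) => [r r0 _|//|//].
by exists r => //; rewrite -lee_fin.
Qed.

Lemma compact_inCMOs b : inL1 b -> paraproduct_compact s b -> inCMOs s b.
Proof.
move=> b1 /compact_uniform_tails tb; split; first exact: uniform_tails_inBMOs.
apply/ereal_cvg0P => [N|e e0]; first exact: carleson_sup_ge0.
exact: uniform_tails_sup.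
Qed.

(** Fatou's lemma along a cluster point, up to a factor 2. *)
Lemma cluster_bound (x : nat -> dyadic -> R) (a : dyadic -> R) nu C :
  (forall J, 0 <= nu J) ->
  (forall (e : R) N m0, 0 < e ->
    exists2 m, (m0 <= m)%N & forall J, J \in levels N -> `|x m J - a J| <= e) ->
  (forall m n, \sum_(J <- levels n) nu J * x m J ^+ 2 <= C) ->
  forall n, \sum_(J <- levels n) nu J * a J ^+ 2 <= 2 * C.
Proof.
move=> nu0 ax xC n; apply/ler_addgt0Pr => e e0.
pose S := \sum_(J <- levels n) nu J; have S0 : 0 <= S by apply: sumr_ge0.
pose d := Num.sqrt (e / (2 * (S + 1))).
have d2 : d ^+ 2 = e / (2 * (S + 1)).
  by rewrite sqr_sqrtr// divr_ge0 ?(ltW e0)// mulr_ge0// addr_ge0.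
have d0 : 0 < d by rewrite sqrtr_gt0 divr_gt0// mulr_gt0// ltr_wpDl.
have [m _ mx] := ax d n 0%N d0.
apply: (@le_trans _ _ (\sum_(J <- levels n) (2 * (nu J * x m J ^+ 2) + 2 * d ^+ 2 * nu J))).
  rewrite big_seq [leRHS]big_seq; apply: ler_sum => J /mx h.
  have h2 : (x m J - a J) ^+ 2 <= d ^+ 2.
    by rewrite -[leLHS]real_normK ?num_real// ler_pXn2r ?nnegrE// ltW.
  have -> : 2 * (nu J * x m J ^+ 2) + 2 * d ^+ 2 * nu J =
     nu J * (2 * x m J ^+ 2 + 2 * d ^+ 2) by ring.
  rewrite ler_wpM2l//; have := sqr_ge0 (2 * x m J - a J); move: h2; nra.
rewrite big_split /= -!mulr_sumr lerD ?ler_wpM2l//.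
rewrite -/S d2 (_ : _ * S = e * (S / (S + 1))).
  by rewrite ler_piMr ?(ltW e0)// ler_pdivrMr ?ltr_wpDl// mul1r lerDl.
by field; rewrite gt_eqF// ltr_wpDl.
Qed.

(** The limit is the Haar series with coefficients (b,h_J) a_J, where a is a
    pointwise cluster point of the averages.  The difference between an image and
    the limit is small on short intervals by the tail embedding, both for the
    averages of the sequence and for their cluster point, and on the finitely
    many long ones by closeness to the cluster point.  As this holds arbitrarily
    far in the sequence, a convergent subsequence can be chosen recursively. *)
Lemma inCMOs_compact b : inCMOs s b -> paraproduct_compact s b.
Proof.
move=> [bB bc]; have [A A0 EA] := (inBMOsP hs0 bB.1).1 bB.
have bA : (carleson_sup s setT b <= A%:E)%E by rewrite EA.
have K0 := embedding_const_gt0 hs0.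
split=> [f fH|f g M fM fg].
  have [g fg] := paraproduct_exists hs0 A0 bA fH; exists g => //.
  have [z z0 Ez] := Hs_normsq_fin fH.
  by have [] := paraproduct_upper hs0 A0 bA fH (_ : (_ <= z%:E)%E) fg; rewrite ?Ez.
have M0 : 0 <= M by rewrite -lee_fin; apply: le_trans (fM 0%N).2; exact: Hs_norm_ge0.
have fH n := (fM n).1; have f2 n := (fH n).1.
have fz n : (Hs_normsq s (f n) <= (M ^+ 2)%:E)%E.
  by rewrite -Hs_norm_le//; exact: (fM n).2.
have fl n : l2sq (f n) <= M ^+ 2.
  have /(Hs_normsqP _ _ (f2 n)) := fz n => /(_ 0%N).
  by rewrite big_nil add0r.
pose x n J := avg (f n) J.
have [a ax] : exists a : dyadic -> R, forall (e : R) N m0, 0 < e ->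
    exists2 m, (m0 <= m)%N & forall J, J \in levels N -> `|x m J - a J| <= e.
  apply: (@pointwise_cluster _ x (fun J => Num.sqrt (2 ^+ tag J * M ^+ 2))) => n J.
  rewrite -sqrtr_sqr ler_wsqrtr//; apply: le_trans (avg_le J (f2 n)) _.
  by rewrite ler_wpM2l// exprn_ge0.
pose c J := inner b (haar J) * a J.
have cE J : q ^+ tag J * c J ^+ 2 = haar_energy s b J * a J ^+ 2.
  by rewrite haar_energyE /c exprMn mulrA.
have cC n : \sum_(J <- levels n) q ^+ tag J * c J ^+ 2 <= 2 * (K * A * M ^+ 2).
  under eq_bigr do rewrite cE; apply: (cluster_bound _ ax).
    by move=> J; exact: haar_energy_ge0.
  move=> m k; under eq_bigr do rewrite /x -paraproduct_coef_energy.
  exact: paraproduct_coef_bound.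
have [h hc] := synthesis (ratio_gt1 hs0) cC.
have [hH _] := is_sum_Hs hs0 hc cC.
have diff m J : q ^+ tag J * (paraproduct_coef b (f m) J - c J) ^+ 2 =
    haar_energy s b J * (x m J - a J) ^+ 2.
  by rewrite haar_energyE /c /paraproduct_coef -mulrBr exprMn mulrA.
have near_h e m0 : 0 < e -> exists m, (m0 <= m)%N /\ (Hs_normsq s (g m \- h)%R <= e%:E)%E.
  (* The factor 3 of [is_sum_Hs] turns e into eta, half of which is spent on the
     short intervals, through d, and half on the long ones, through u. *)
  move=> e0; pose eta := e / 3; have eta0 : 0 < eta by rewrite divr_gt0.
  pose d := eta / (12 * (K * (M ^+ 2 + 1))).
  have M1 : 0 < M ^+ 2 + 1 by rewrite ltr_wpDl// sqr_ge0.
  have d0 : 0 < d by rewrite divr_gt0// !mulr_gt0.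
  have [N HN] := (ereal_cvg0P (fun n => carleson_sup_ge0 hs0 _ b)).1 bc d d0.
  have {}HN := HN N (leqnn N).
  have cd := carleson_of_sup hs0 (ltW d0) HN.
  have xd m n : \sum_(J <- levels n) weight s (short_set N) b J * x m J ^+ 2 <= K * d * M ^+ 2.
    exact: (carleson_embedding_le hs0 n (weight_ge0 s _ b) cd (fH m) (fz m)).
  have ad := cluster_bound (weight_ge0 s _ b) ax xd.
  pose S := \sum_(J <- levels N.+1) haar_energy s b J.
  have S0 : 0 <= S by apply: sumr_ge0 => J _; exact: haar_energy_ge0.
  pose u := Num.sqrt (eta / (2 * (S + 1))).
  have u2 : u ^+ 2 = eta / (2 * (S + 1)).
    by rewrite sqr_sqrtr// divr_ge0 ?(ltW eta0)// mulr_ge0// addr_ge0.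
  have u0 : 0 < u by rewrite sqrtr_gt0 divr_gt0// mulr_gt0// ltr_wpDl.
  have [m mm0 mx] := ax u N.+1 m0 u0; exists m; split => //.
  have gc := is_sumB (fg m : is_sum (paraproduct_coef b (f m)) (g m)) hc.
  suff H n : \sum_(J <- levels n) q ^+ tag J * (paraproduct_coef b (f m) J - c J) ^+ 2 <= eta.
    by have [_] := is_sum_Hs hs0 gc H; rewrite /eta mulrC divfK.
  have E J : q ^+ tag J * (paraproduct_coef b (f m) J - c J) ^+ 2 =
      weight s (short_set N) b J * (x m J - a J) ^+ 2 +
      if (tag J <= N)%N then haar_energy s b J * (x m J - a J) ^+ 2 else 0.
    by rewrite diff weight_shortE; case: ltnP => _; rewrite ?mul0r ?add0r ?addr0.
  under eq_bigr do rewrite E.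
  rewrite big_split /= -big_mkcond /= -[X in _ + X <= _]big_filter [eta]splitr lerD//.
    apply: (@le_trans _ _ (\sum_(J <- levels n) (2 * (weight s (short_set N) b J * x m J ^+ 2) +
        2 * (weight s (short_set N) b J * a J ^+ 2)))).
      apply: ler_sum => J _.
      have -> : 2 * (weight s (short_set N) b J * x m J ^+ 2) +
         2 * (weight s (short_set N) b J * a J ^+ 2) =
         weight s (short_set N) b J * (2 * x m J ^+ 2 + 2 * a J ^+ 2) by ring.
      rewrite ler_wpM2l ?weight_ge0//; have := sqr_ge0 (x m J + a J); nra.
    rewrite big_split /= -!mulr_sumr.
    have h1 := xd m n; have h2 := ad n.
    (* 2 for the averages and 2 * 2 for the cluster point. *)
    have h3 : 6 * (K * d * M ^+ 2) <= eta / 2.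
      rewrite /d (_ : 6 * _ = eta / 2 * (M ^+ 2 / (M ^+ 2 + 1))).
        apply: ler_piMr; first by rewrite ltW// divr_gt0.
        by rewrite ler_pdivrMr// mul1r lerDl.
      by field; rewrite !gt_eqF.
    lra.
  apply: (@le_trans _ _ (u ^+ 2 * S)); last first.
    rewrite u2 (_ : _ * S = eta / 2 * (S / (S + 1))).
      apply: ler_piMr; first by rewrite ltW// divr_gt0.
      by rewrite ler_pdivrMr ?ltr_wpDl// mul1r lerDl.
    by field; rewrite gt_eqF// ltr_wpDl.
  rewrite /S mulr_sumr.
  apply: (@le_trans _ _ (\sum_(J <- [seq J <- levels n | (tag J <= N)%N])
      u ^+ 2 * haar_energy s b J)).
    rewrite big_seq [leRHS]big_seq; apply: ler_sum => J.
    rewrite mem_filter => /andP[JN _]; rewrite mulrC ler_wpM2r ?haar_energy_ge0//.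
    rewrite -[leLHS]real_normK ?num_real// ler_pXn2r ?nnegrE ?(ltW u0)//.
    by apply: mx; rewrite mem_levels.
  apply: ler_sum_sub; rewrite ?filter_uniq ?uniq_levels// => J.
    by rewrite mem_filter !mem_levels ltnS => /andP[].
  by rewrite mulr_ge0 ?haar_energy_ge0// sqr_ge0.
have inv0 k : 0 < (k.+1%:R^-1 : R) ^+ 2 by rewrite exprn_gt0// invr_gt0.
have /choice[F HF] : forall p : nat * nat, exists m, (p.2 <= m)%N /\
    (Hs_normsq s (g m \- h)%R <= ((p.1.+1%:R^-1) ^+ 2)%:E)%E.
  by move=> [k m0]; exact: near_h.
(* [F (k, m0)] is an index at least m0 whose image is 1/(k+1)-close to h. *)
pose phi := fix phi n := if n is k.+1 then F (k.+1, (phi k).+1) else F (0%N, 0%N).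
exists phi, h; split => //.
  by apply: homo_ltn => [|n]; [exact: ltn_trans|exact: (HF (n.+1, (phi n).+1)).1].
have phi_near n : (Hs_norm s (g (phi n) \- h)%R <= (n.+1%:R^-1)%:E)%E.
  by rewrite Hs_norm_le ?invr_ge0//; case: n => [|n]; exact: (HF (_, _)).2.
apply/ereal_cvg0P => [n|e e0]; first exact: Hs_norm_ge0.
exists (Num.truncn e^-1) => n nN; apply: le_trans (phi_near n) _; rewrite lee_fin.
rewrite -[leRHS]invrK lef_pV2 ?posrE ?invr_gt0//.
by apply: ltW; apply: lt_le_trans (truncnS_gt _) _; rewrite ler_nat ltnS.
Qed.

End Compactness.

Theorem theorem1p1 (R : realType) (s : R) (hs0 : 0 < s) (hs1 : s < 1) :
  (forall b : R -> R, inL1 b -> (paraproduct_bounded s b <-> inBMOs s b)) /\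
  (exists c C : R, [/\ 0 < c, 0 < C &
    forall b : R -> R, inBMOs s b ->
      (c%:E * BMOs_norm s b <= paraproduct_opnorm s b)%E /\
      (paraproduct_opnorm s b <= C%:E * BMOs_norm s b)%E]) /\
  (forall b : R -> R, inL1 b -> (paraproduct_compact s b <-> inCMOs s b)).
Proof.
split; first by move=> b; exact: paraproduct_bounded_iff.
split.
  exists 1, (Num.sqrt (3 * embedding_const s)); split => //.
    by rewrite sqrtr_gt0 mulr_gt0// embedding_const_gt0.
  by move=> b; exact: paraproduct_opnorm_equiv.
by move=> b b1; split; [exact: compact_inCMOs|exact: inCMOs_compact].
Qed.
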